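(* Let $S$ and $S'$ be two non-simple, indecomposable basic formal matrix rings of orders $n$ and $n'$ with Nakayama permutations $\sigma\in S_n$ and $\sigma'\in S_{n'}$, respectively. Let $\pi$ be the concatenation of $\sigma$ and $\sigma'$. Assume that there exist idempotents $e\in S$ and $e'\in S'$ (sums of canonical idempotents) such that $eSe$ and $e'S'e'$ are rings with Nakayama permutations which are the restrictions of $\sigma$ and $\sigma'$, respectively. Furthermore, writing $P=eSe$ and $P'=e'S'e'$ as basic formal matrix rings with Nakayama permutations $\rho$ and $\rho'$ (the restrictions), and with local corners $P_i$ and $P'_i$, assume that: (A) all residue skew fields of local corner rings of $P$ are isomorphic to a fixed skew field $K$; (A') all residue skew fields of local corner rings of $P'$ are isomorphic to a fixed skew field $L$; (B) the skew fields $K$ and $L$ are compatible; (C) for any index $i$ of $P$, the simple submodules $T_{\rho(i)}$ and $T'_i$ of the pairing coordinate bimodule of $P$ at position $(i,\rho(i))$ coincide, and $T'_i$ is isomorphic to $K$ as a $P_i$-$P_{\rho(i)}$-bimodule; (C') for any index $i$ of $P'$, the simple submodules $T_{\rho'(i)}$ and $T'_i$ of the pairing coordinate bimodule of $P'$ at position $(i,\rho'(i))$ coincide, and $T'_i$ is isomorphic to $L$ as a $P'_i$-$P'_{\rho'(i)}$-bimodule; (D) for any fixed point $i$ of $\rho$, the local corner $P_i$ is not simple; (D') for any fixed point $i$ of $\rho'$, the local corner $P'_i$ is not simple. Then there exists an indecomposable basic ring $R$ of order $n+n'$ with a Nakayama permutation $\pi$ and an idempotent $f\in R$ such that $fRf\cong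 S$ and $(1-f)R(1-f)\cong S'$ as rings, and such that, furthermore, $R$ has an essential right socle if and only if $S$ and $S'$ have essential right socles.
   Context: Rings are associative and unital; $J(R)$ is the Jacobson radical; $S_n$ is the symmetric group on $\{1,\dots,n\}$. Formal matrix ring of order $n$: given local rings $R_1,\dots,R_n$ (local corners), $R_i$-$R_j$-bimodules $B_{i,j}$ (coordinate bimodules) with $B_{i,i}=R_i$, and $R_i$-$R_k$-bimodule homomorphisms $\varphi_{i,j,k}\colon B_{i,j}\otimes_{R_j}B_{j,k}\to B_{i,k}$, written $ab:=\varphi_{i,j,k}(a\otimes b)$, where $\varphi_{i,i,j}$ and $\varphi_{i,j,j}$ are the bimodule actions and $(ab)c=a(bc)$ for all $a\in B_{i,j}$, $b\in B_{j,k}$, $c\in B_{k,l}$. The ring $R$ is the set of $n\times n$ matrices whose $(i,j)$ entry lies in $B_{i,j}$, with the usual matrix addition and multiplication. The canonical idempotent $e_i$ is the matrix with $1_{R_i}$ at position $(i,i)$ and zeros elsewhere. $R$ is basic if the right modules $e_1R,\dots,e_nR$ are pairwise non-isomorphic; ''basic ring of order $n+n'$'' means basic formal matrix ring of order $n+n'$. The residue skew field of a local ring $R_i$ is $R_i/J(R_i)$. A ring is indecomposable if it is not a direct product of two nonzero rings. A ring has an essential right socle if its right socle is essential as a right ideal. Nakayama permutation: a basic formal matrix ring $R$ of order $n$ is a ring with a Nakayama permutation $\pi\in S_n$ if for each $i\le n$ one has $soc(e_iR)\cong top(e_{\pi(i)}R)$ as right $R$-modules and $soc(Re_{\pi(i)})\cong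 top(Re_i)$ as left $R$-modules, where $top(M)=M/MJ(R)$ (resp. $M/J(R)M$). Then $B_{i,\pi(i)}$ is called a pairing coordinate bimodule. $T_{\pi(i)}$ denotes the socle, as a right $R_{\pi(i)}$-module, of $\{m\in B_{i,\pi(i)} : mB_{\pi(i),j}=0\text{ for all }j\neq\pi(i)\}$, and $T'_i$ denotes the socle, as a left $R_i$-module, of $\{m\in B_{i,\pi(i)} : B_{h,i}m=0\text{ for all }h\neq i\}$; these are simple one-sided modules. This notation is used for $P$ with $\rho$ and for $P'$ with $\rho'$ (all indices ranging over the index set of $P$, resp. $P'$, i.e. the set of indices of the canonical idempotents summing to $e$, resp. $e'$). Two skew fields $K$ and $L$ are compatible if $K$ admits a $K$-$L$-bimodule structure and $L$ admits an $L$-$K$-bimodule structure (where the left action of $K$ on $K$, resp. of $L$ on $L$, is by multiplication). In (C), $K$ is a bimodule over $P_i$ and $P_{\rho(i)}$ via the canonical projections onto the residue skew fields followed by fixed isomorphisms with $K$ as in (A); similarly for $L$ in (C'). Concatenation: view $\sigma\in S_n$ and $\sigma'\in S_{n'}$ as elements of $S_{n+n'}$ fixing the extra elements, and let $\tau_n\in S_{n+n'}$ be $i\mapsto i+n \pmod{n+n'}$. The concatenation of $\sigma$ and $\sigma'$ is $\sigma\circ(\tau_n\circ\sigma'\circ\tau_n^{-1})\in S_{n+n'}$; i.e. it acts as $\sigma$ on $\{1,\dots,n\}$ and as $n+i\mapsto n+\sigma'(i)$ on $\{n+1,\dots,n+n'\}$. *)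

(* Defs.v *)
From HB Require Import structures.
From mathcomp Require Import all_boot perm all_algebra.
From mathcomp Require Import boolp.

Set Implicit Arguments.
Unset Strict Implicit.
Unset Printing Implicit Defensive.

Import GRing.Theory.
Local Open Scope ring_scope.
Local Open Scope quotient_scope.

(* Left R-modules are [lmodType R]; right R-modules are left modules over the
   converse ring, [lmodType R^c], where [a *: m] stands for [m a].
   All the module theory below is written for left modules and is applied to
   right modules through [R^c].  In particular [R^o] is R as a left module over
   itself and [(R^c)^o] is R as a right module over itself. *)

Record submod (R : pzRingType) (M : lmodType R) := Submod {
  submod_pred :> {pred M};
  submodP : submod_closed submod_pred
}.

HB.instance Definition _ (R : pzRingType) (M : lmodType R) (N : submod M) :=
  GRing.isSubmodClosed.Build R M (submod_pred N) (submodP N).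

Definition submod_type (R : pzRingType) (M : lmodType R) (N : submod M) : Type :=
  {x : M | x \in submod_pred N}.

HB.instance Definition _ (R : pzRingType) (M : lmodType R) (N : submod M) :=
  SubChoice.on (submod_type N).
HB.instance Definition _ (R : pzRingType) (M : lmodType R) (N : submod M) :=
  GRing.SubChoice_isSubLmodule.Build R M _ (submod_type N) (submodP N).

Definition quomod (R : pzRingType) (M : lmodType R) (N : submod M) : Type :=
  Quotient.quot (submod_pred N).

Section QuotientModule.
Variables (R : pzRingType) (M : lmodType R) (N : submod M).

HB.instance Definition _ := GRing.Zmodule.on (quomod N).

Definition quomod_pi (x : M) : quomod N :=
  \pi_(Quotient.quot (submod_pred N)) x.

Definition quomod_scale (a : R) (u : quomod N) : quomod N :=
  quomod_pi (a *: repr (u : Quotient.quot (submod_pred N))).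

Fact quomod_piP x y : quomod_pi x = quomod_pi y <-> x - y \in submod_pred N.
Proof.
rewrite Quotient.idealrBE; split=> [h|/eqP //]; exact/eqP.
Qed.

Fact quomod_pi_repr (u : quomod N) :
  quomod_pi (repr (u : Quotient.quot (submod_pred N))) = u.
Proof. exact: reprK. Qed.

Fact quomod_piD x y : quomod_pi (x + y) = quomod_pi x + quomod_pi y.
Proof. exact: (Quotient.pi_add (submod_pred N) x y). Qed.

Fact quomod_piZ a x : quomod_scale a (quomod_pi x) = quomod_pi (a *: x).
Proof.
apply/quomod_piP; rewrite -scalerBr; apply: rpredZ.
by apply/quomod_piP; rewrite quomod_pi_repr.
Qed.

Fact quomod_scalerA a b u :
  quomod_scale a (quomod_scale b u) = quomod_scale (a * b) u.
Proof. by rewrite -[u]quomod_pi_repr !quomod_piZ scalerA. Qed.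

Fact quomod_scale1r : left_id 1 quomod_scale.
Proof. by move=> u; rewrite -[u]quomod_pi_repr quomod_piZ scale1r. Qed.

Fact quomod_scalerDr : right_distributive quomod_scale +%R.
Proof.
move=> a u v; rewrite -[u]quomod_pi_repr -[v]quomod_pi_repr.
by rewrite -quomod_piD !quomod_piZ scalerDr quomod_piD.
Qed.

Fact quomod_scalerDl u : {morph quomod_scale^~ u : a b / a + b}.
Proof.
by move=> a b; rewrite -[u]quomod_pi_repr !quomod_piZ scalerDl quomod_piD.
Qed.

HB.instance Definition _ := GRing.Zmodule_isLmodule.Build R (quomod N)
  quomod_scalerA quomod_scale1r quomod_scalerDr quomod_scalerDl.

End QuotientModule.

Definition mod_iso (R : pzRingType) (M N : lmodType R) : Prop :=
  exists f : {linear M -> N}, bijective f.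

Definition ring_iso (R S : pzRingType) : Prop :=
  exists f : {rmorphism R -> S}, bijective f.

Section ModuleNotions.
Variables (R : pzRingType) (M : lmodType R).

Definition span_pred (P : M -> Prop) : {pred M} :=
  fun x => `[< forall N : submod M, (forall y, P y -> y \in N) -> x \in N >].

Fact span_closed P : submod_closed (span_pred P).
Proof.
split=> [|a u v /asboolP hu /asboolP hv].
  by apply/asboolP=> N _; apply: rpred0.
apply/asboolP=> N hN; apply: rpredD; last exact: hv.
by apply: rpredZ; apply: hu.
Qed.

Definition submod_span (P : M -> Prop) : submod M := Submod (span_closed P).

Definition simple_mod : Prop :=
  (exists x : M, x != 0) /\
  (forall N : submod M, (forall x, x \in N -> x = 0) \/ (forall x, x \in N)).

Definition maximal_submod (N : submod M) : Prop :=
  (exists x, x \notin N) /\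
  (forall N' : submod M, {subset N <= N'} ->
     {subset N' <= N} \/ (forall x, x \in N')).

Definition essential (N : submod M) : Prop :=
  forall N' : submod M, (exists2 x, x \in N' & x != 0) ->
    exists x, [/\ x \in N, x \in N' & x != 0].

End ModuleNotions.

Definition socle (R : pzRingType) (M : lmodType R) : submod M :=
  submod_span (fun x => exists2 N : submod M, simple_mod (submod_type N) & x \in N).

(* J M, the additive span of the products a *: m, provided that J is a left ideal
   of R.  For right modules J is a right ideal of the ring and this is M J; the
   same set J(R) is used for the tops of left and of right R-modules. *)
Definition scale_span (R : pzRingType) (J : {pred R}) (M : lmodType R) :
    submod M :=
  submod_span (fun x => exists a m, a \in J /\ x = a *: m).

Definition top_mod (R : pzRingType) (J : {pred R}) (M : lmodType R) :
    lmodType R :=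
  quomod (scale_span J M).

Definition jacobson (R : pzRingType) : {pred R} :=
  fun x => `[< forall m : submod R^o, maximal_submod m -> (x : R^o) \in m >].
Arguments jacobson R : clear implicits.

Definition local_ring (R : pzRingType) : Prop :=
  exists2 m : submod R^o, maximal_submod m &
    forall m' : submod R^o, maximal_submod m' -> m' =i m.

Definition essential_right_socle (R : pzRingType) : Prop :=
  essential (socle (R^c)^o).

Section Residue.
Variable R : pzRingType.

Fact jacobson_closed : @submod_closed R R^o (jacobson R).
Proof.
split=> [|a u v /asboolP hu /asboolP hv].
  by apply/asboolP=> m _; apply: rpred0.
apply/asboolP=> m hm; apply: (@rpredD _ m); last exact: hv.
by apply: (@rpredZ _ R^o m); apply: hu.
Qed.

Definition jacobson_submod : submod R^o := Submod jacobson_closed.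

Fact jacobsonMl a x : x \in jacobson R -> a * x \in jacobson R.
Proof. exact: (@rpredZ _ R^o jacobson_submod). Qed.

Lemma right_colon_closed (m : submod R^o) (r : R) :
  @submod_closed R R^o [pred y : R^o | (y : R) * r \in m].
Proof.
split=> [|a u v]; rewrite !inE; first by rewrite mul0r; apply: rpred0.
move=> hu hv; rewrite mulrDl; apply: rpredD => //.
by rewrite -mulrA; apply: (@rpredZ _ R^o m).
Qed.

Lemma add_left_closed (m : submod R^o) (z : R) :
  @submod_closed R R^o
    (fun x : R^o => `[< exists2 u, u \in m & exists b : R, x = u + b * z >]).
Proof.
split=> [|a x y /asboolP[u hu [b ->]] /asboolP[v hv [c ->]]]; apply/asboolP.
  by exists 0; [apply: rpred0 | exists 0; rewrite mul0r addr0].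
exists (a *: u + v); first by apply: rpredD => //; apply: rpredZ.
exists (a * b + c); rewrite scalerDr mulrDl -mulrA addrACA; congr (_ + _).
Qed.

Fact jacobsonMr x r : x \in jacobson R -> x * r \in jacobson R.
Proof.
move=> /asboolP hx; apply/asboolP=> m hm.
have [hr|nr] := boolP ((r : R^o) \in m); first exact: (@rpredZ _ R^o m).
pose N := Submod (right_colon_closed m r).
suff hN : maximal_submod N by have := hx N hN; rewrite inE.
split; first by exists (1 : R); rewrite inE mul1r.
move=> N' sNN'.
have [[y yN' yN]|hall] := pselect (exists2 y : R^o, y \in N' & y \notin N).
  right.
  pose m' := Submod (add_left_closed m (y * r)).
  have smm' : {subset m <= m'}.
    move=> u hu; apply/asboolP; exists u => //; exists 0.
    by rewrite mul0r addr0.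
  have [sm'm|/(_ r)/asboolP[u hu [b rE]]] := hm.2 m' smm'.
    case/negP: yN; rewrite inE; apply: sm'm; apply/asboolP.
    by exists 0; [apply: rpred0 | exists 1; rewrite mul1r add0r].
  have h1 : (1 - b * y : R^o) \in N'.
    apply: sNN'; rewrite inE mulrBl mul1r -mulrA.
    by rewrite [X in X - _]rE addrK.
  have h1N : (1 : R^o) \in N'.
    rewrite -[1](subrK (b * y : R^o)); apply: rpredD => //.
    exact: (@rpredZ _ R^o N').
  by move=> z; rewrite -[z]mulr1; apply: (@rpredZ _ R^o N').
left=> y hy; apply: contrapT => /negP nyN; apply: hall; by exists y.
Qed.

Definition residue : Type := quomod jacobson_submod.

HB.instance Definition _ := GRing.Zmodule.on residue.

Definition residue_pi (x : R) : residue := quomod_pi jacobson_submod x.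

Definition residue_mul (u v : residue) : residue :=
  residue_pi (repr (u : Quotient.quot (submod_pred jacobson_submod)) *
              repr (v : Quotient.quot (submod_pred jacobson_submod))).

Fact residue_piM x y :
  residue_mul (residue_pi x) (residue_pi y) = residue_pi (x * y).
Proof.
apply/quomod_piP; set x' := repr _; set y' := repr _.
have hx : (x' - x : R^o) \in submod_pred jacobson_submod by apply/quomod_piP; rewrite quomod_pi_repr.
have hy : (y' - y : R^o) \in submod_pred jacobson_submod by apply/quomod_piP; rewrite quomod_pi_repr.
have -> : x' * y' - x * y = x' * (y' - y) + (x' - x) * y :> R.
  by rewrite mulrBr mulrBl addrA subrK.
by apply: (@rpredD _ jacobson_submod); [apply: jacobsonMl | apply: jacobsonMr].
Qed.

Fact residue_pi_surj (u : residue) : exists x, u = residue_pi x.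
Proof.
exists (repr (u : Quotient.quot (submod_pred jacobson_submod))).
exact/esym/quomod_pi_repr.
Qed.

Fact residue_piD x y : residue_pi (x + y) = residue_pi x + residue_pi y.
Proof. exact: quomod_piD. Qed.

Fact residue_mulA : associative residue_mul.
Proof.
move=> u v w; have [x ->] := residue_pi_surj u.
have [y ->] := residue_pi_surj v; have [z ->] := residue_pi_surj w.
by rewrite !residue_piM mulrA.
Qed.

Fact residue_mul1 : left_id (residue_pi 1) residue_mul.
Proof. by move=> u; have [x ->] := residue_pi_surj u; rewrite residue_piM mul1r. Qed.

Fact residue_mulr1 : right_id (residue_pi 1) residue_mul.
Proof. by move=> u; have [x ->] := residue_pi_surj u; rewrite residue_piM mulr1. Qed.

Fact residue_mulDl : left_distributive residue_mul +%R.
Proof.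
move=> u v w; have [x ->] := residue_pi_surj u.
have [y ->] := residue_pi_surj v; have [z ->] := residue_pi_surj w.
by rewrite -residue_piD !residue_piM mulrDl residue_piD.
Qed.

Fact residue_mulDr : right_distributive residue_mul +%R.
Proof.
move=> u v w; have [x ->] := residue_pi_surj u.
have [y ->] := residue_pi_surj v; have [z ->] := residue_pi_surj w.
by rewrite -residue_piD !residue_piM mulrDr residue_piD.
Qed.

HB.instance Definition _ := GRing.Zmodule_isPzRing.Build residue
  residue_mulA residue_mul1 residue_mulr1 residue_mulDl residue_mulDr.

End Residue.

Definition skew_field (K : pzRingType) : Prop :=
  (1 : K) != 0 /\ forall x : K, x != 0 -> exists y, y * x = 1 /\ x * y = 1.

Definition simple_ring (R : pzRingType) : Prop :=
  (1 : R) != 0 /\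
  forall I : submod R^o, (forall (x a : R), x \in I -> x * a \in I) ->
    (forall x, x \in I -> x = 0) \/ (forall x, x \in I).

Definition indecomposable_ring (R : pzRingType) : Prop :=
  forall A B : nzRingType, ~ ring_iso R (A * B)%type.

Record right_action (L : pzRingType) (M : zmodType) (r : M -> L -> M) : Prop :=
  RightAction {
    ractDl : forall x y l, r (x + y) l = r x l + r y l;
    ractDr : forall x l l', r x (l + l') = r x l + r x l';
    ract1  : forall x, r x 1 = x;
    ractM  : forall x l l', r x (l * l') = r (r x l) l'
  }.

(* The left action of K on K is by multiplication. *)
Definition admits_bimodule (K L : pzRingType) : Prop :=
  exists2 r : K -> L -> K, right_action r &
    forall a x l, r (a * x) l = a * r x l.

Definition compatible (K L : pzRingType) : Prop :=
  admits_bimodule K L /\ admits_bimodule L K.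

Record idem_elt (R : pzRingType) := Idempotent {
  idem_val : R;
  idemP : idem_val * idem_val = idem_val
}.

Fact idem_compl_subproof (R : pzRingType) (f : idem_elt R) :
  (1 - idem_val f) * (1 - idem_val f) = 1 - idem_val f.
Proof. by rewrite mulrBr mulr1 mulrBl mul1r idemP subrr subr0. Qed.

Definition idem_compl (R : pzRingType) (f : idem_elt R) : idem_elt R :=
  Idempotent (idem_compl_subproof f).

Section Peirce.
Variables (R : pzRingType) (f : idem_elt R).

Definition peirce_pred : {pred R} := fun x => idem_val f * x * idem_val f == x.

Fact peirce_zmod_closed : zmod_closed peirce_pred.
Proof.
split=> [|x y /eqP hx /eqP hy]; apply/eqP; first by rewrite mulr0 mul0r.
by rewrite mulrBr mulrBl hx hy.
Qed.

HB.instance Definition _ := GRing.isZmodClosed.Build R peirce_pred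
  peirce_zmod_closed.

Definition peirce : Type := {x : R | x \in peirce_pred}.

HB.instance Definition _ := SubChoice.on peirce.
HB.instance Definition _ :=
  GRing.SubChoice_isSubZmodule.Build R _ peirce peirce_zmod_closed.

Fact peirce_idl (x : peirce) : idem_val f * val x = val x.
Proof. by rewrite -(eqP (valP x)) !mulrA idemP. Qed.

Fact peirce_idr (x : peirce) : val x * idem_val f = val x.
Proof. by rewrite -(eqP (valP x)) -!mulrA idemP. Qed.

Fact peirce_one_subproof : idem_val f \in peirce_pred.
Proof. by apply/eqP; rewrite !idemP. Qed.

Fact peirce_mul_subproof (x y : peirce) : val x * val y \in peirce_pred.
Proof. by apply/eqP; rewrite mulrA peirce_idl -mulrA peirce_idr. Qed.

Definition peirce_one : peirce := exist _ (idem_val f) peirce_one_subproof.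
Definition peirce_mul (x y : peirce) : peirce :=
  exist _ (val x * val y) (peirce_mul_subproof x y).

Fact peirce_mulA : associative peirce_mul.
Proof. by move=> x y z; apply: val_inj; rewrite /= mulrA. Qed.
Fact peirce_mul1 : left_id peirce_one peirce_mul.
Proof. by move=> x; apply: val_inj; rewrite /= peirce_idl. Qed.
Fact peirce_mulr1 : right_id peirce_one peirce_mul.
Proof. by move=> x; apply: val_inj; rewrite /= peirce_idr. Qed.
Fact peirce_mulDl : left_distributive peirce_mul +%R.
Proof. by move=> x y z; apply: val_inj; rewrite /= mulrDl. Qed.
Fact peirce_mulDr : right_distributive peirce_mul +%R.
Proof. by move=> x y z; apply: val_inj; rewrite /= mulrDr. Qed.

HB.instance Definition _ := GRing.Zmodule_isPzRing.Build peirce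
  peirce_mulA peirce_mul1 peirce_mulr1 peirce_mulDl peirce_mulDr.

End Peirce.

(* The index set is an arbitrary finite type I, so that e S e, for e a sum of
   canonical idempotents, is again indexed by the corresponding set of indices.
   The local corner R_i is B_{i,i} with the product phi_{i,i,i}, and the
   R_i-R_j-bimodule structure of B_{i,j} is given by phi_{i,i,j} and
   phi_{i,j,j}.  A bimodule homomorphism on the tensor product B_{i,j} (x) B_{j,k}
   is a biadditive map which is R_j-balanced, left R_i-linear and right
   R_k-linear; these three conditions, as well as the ring and bimodule axioms,
   are the instances of associativity in which some of the indices agree. *)
Record fmdata (I : finType) := FMData {
  bimod : I -> I -> zmodType;
  fm_one : forall i, bimod i i;
  fm_mul : forall i j k, bimod i j -> bimod j k -> bimod i k;
  fm_mulDl : forall i j k (a a' : bimod i j) (b : bimod j k),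
    fm_mul (a + a') b = fm_mul a b + fm_mul a' b;
  fm_mulDr : forall i j k (a : bimod i j) (b b' : bimod j k),
    fm_mul a (b + b') = fm_mul a b + fm_mul a b';
  fm_mulA : forall i j k l (a : bimod i j) (b : bimod j k) (c : bimod k l),
    fm_mul a (fm_mul b c) = fm_mul (fm_mul a b) c;
  fm_mul1l : forall i j (a : bimod i j), fm_mul (fm_one i) a = a;
  fm_mul1r : forall i j (a : bimod i j), fm_mul a (fm_one j) = a
}.

Section FMData.
Variables (I : finType) (S : fmdata I).

Definition corner (i : I) : Type := bimod S i i.
HB.instance Definition _ i := GRing.Zmodule.on (corner i).
HB.instance Definition _ i := GRing.Zmodule_isPzRing.Build (corner i)
  (@fm_mulA _ S i i i i) (@fm_mul1l _ S i i) (@fm_mul1r _ S i i)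
  (@fm_mulDl _ S i i i) (@fm_mulDr _ S i i i).

(* B_{i,j} as a left R_i-module *)
Definition lbimod (i j : I) : Type := bimod S i j.
HB.instance Definition _ i j := GRing.Zmodule.on (lbimod i j).
HB.instance Definition _ i j :=
  GRing.Zmodule_isLmodule.Build (corner i) (lbimod i j)
    (@fm_mulA _ S i i i j) (@fm_mul1l _ S i j)
    (@fm_mulDr _ S i i j) (fun m a b => @fm_mulDl _ S i i j a b m).

(* B_{i,j} as a right R_j-module *)
Definition rbimod (i j : I) : Type := bimod S i j.
HB.instance Definition _ i j := GRing.Zmodule.on (rbimod i j).
HB.instance Definition _ i j :=
  GRing.Zmodule_isLmodule.Build ((corner j)^c) (rbimod i j)
    (fun a b m => esym (@fm_mulA _ S i j j j m b a)) (@fm_mul1r _ S i j)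
    (fun a m m' => @fm_mulDl _ S i j j m m' a) (@fm_mulDr _ S i j j).

Fact fm_mul0l i j k (b : bimod S j k) : fm_mul (0 : bimod S i j) b = 0.
Proof. by apply: (addIr (fm_mul (0 : bimod S i j) b)); rewrite -fm_mulDl !add0r. Qed.

Fact fm_mul0r i j k (a : bimod S i j) : fm_mul a (0 : bimod S j k) = 0.
Proof. by apply: (addIr (fm_mul a (0 : bimod S j k))); rewrite -fm_mulDr !add0r. Qed.

Fact fm_mul_suml i j k (F : I -> bimod S i j) (b : bimod S j k) :
  fm_mul (\sum_h F h) b = \sum_h fm_mul (F h) b.
Proof.
by apply: (big_morph (fun x => fm_mul x b)) => [x y|];
  [apply: fm_mulDl | apply: fm_mul0l].
Qed.

Fact fm_mul_sumr i j k (a : bimod S i j) (F : I -> bimod S j k) :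
  fm_mul a (\sum_h F h) = \sum_h fm_mul a (F h).
Proof.
by apply: (big_morph (fun x => fm_mul a x)) => [x y|];
  [apply: fm_mulDr | apply: fm_mul0r].
Qed.

(* The (i, j) entry of the identity matrix; the equality i = j has to be
   transported to the type of entries. *)
Definition fm_delta (i j : I) : bimod S i j :=
  match i =P j with
  | ReflectT e => eq_rect i (bimod S i) (fm_one S i) j e
  | ReflectF _ => 0
  end.

Fact fm_delta_id i : fm_delta i i = fm_one S i.
Proof. by rewrite /fm_delta; case: eqP => // e; rewrite eq_axiomK. Qed.

Fact fm_delta_neq i j : i != j -> fm_delta i j = 0.
Proof. by rewrite /fm_delta; case: eqP. Qed.

Definition fmx : Type := {dffun forall p : I * I, bimod S p.1 p.2}.

HB.instance Definition _ := Choice.on fmx.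

Definition mkfmx (F : forall i j, bimod S i j) : fmx :=
  finfun (fun p : I * I => F p.1 p.2).

Definition entry (A : fmx) (i j : I) : bimod S i j := A (i, j).

Fact mkfmxE F i j : entry (mkfmx F) i j = F i j.
Proof. by rewrite /entry /mkfmx ffunE. Qed.

Fact fmxP (A B : fmx) : (forall i j, entry A i j = entry B i j) -> A = B.
Proof. by move=> h; apply/ffunP=> -[i j]; apply: h. Qed.

Definition fmx_zero : fmx := mkfmx (fun i j => 0).
Definition fmx_opp (A : fmx) : fmx := mkfmx (fun i j => - entry A i j).
Definition fmx_add (A B : fmx) : fmx :=
  mkfmx (fun i j => entry A i j + entry B i j).
Definition fmx_one : fmx := mkfmx fm_delta.
Definition fmx_mul (A B : fmx) : fmx :=
  mkfmx (fun i j => \sum_k fm_mul (entry A i k) (entry B k j)).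

Fact fmx_addA : associative fmx_add.
Proof. by move=> A B C; apply: fmxP => i j; rewrite !mkfmxE addrA. Qed.
Fact fmx_addC : commutative fmx_add.
Proof. by move=> A B; apply: fmxP => i j; rewrite !mkfmxE addrC. Qed.
Fact fmx_add0 : left_id fmx_zero fmx_add.
Proof. by move=> A; apply: fmxP => i j; rewrite !mkfmxE add0r. Qed.
Fact fmx_addN : left_inverse fmx_zero fmx_opp fmx_add.
Proof. by move=> A; apply: fmxP => i j; rewrite !mkfmxE addNr. Qed.

Fact fmx_mulA : associative fmx_mul.
Proof.
move=> A B C; apply: fmxP => i j; rewrite !mkfmxE.
under eq_bigr do rewrite mkfmxE fm_mul_sumr.
rewrite exchange_big; apply: eq_bigr => h _.
by rewrite mkfmxE fm_mul_suml; apply: eq_bigr => k _; rewrite fm_mulA.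
Qed.

Fact fmx_mul1 : left_id fmx_one fmx_mul.
Proof.
move=> A; apply: fmxP => i j; rewrite mkfmxE (bigD1 i) //= mkfmxE fm_delta_id.
rewrite fm_mul1l big1 ?addr0 // => k ki.
by rewrite mkfmxE fm_delta_neq 1?eq_sym // fm_mul0l.
Qed.

Fact fmx_mulr1 : right_id fmx_one fmx_mul.
Proof.
move=> A; apply: fmxP => i j; rewrite mkfmxE (bigD1 j) //= mkfmxE fm_delta_id.
by rewrite fm_mul1r big1 ?addr0 // => k ki; rewrite mkfmxE fm_delta_neq // fm_mul0r.
Qed.

Fact fmx_mulDl : left_distributive fmx_mul fmx_add.
Proof.
move=> A B C; apply: fmxP => i j; rewrite !mkfmxE -big_split.
by apply: eq_bigr => k _; rewrite mkfmxE fm_mulDl.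
Qed.

Fact fmx_mulDr : right_distributive fmx_mul fmx_add.
Proof.
move=> A B C; apply: fmxP => i j; rewrite !mkfmxE -big_split.
by apply: eq_bigr => k _; rewrite mkfmxE fm_mulDr.
Qed.

HB.instance Definition _ := GRing.isZmodule.Build fmx
  fmx_addA fmx_addC fmx_add0 fmx_addN.
HB.instance Definition _ := GRing.Zmodule_isPzRing.Build fmx
  fmx_mulA fmx_mul1 fmx_mulr1 fmx_mulDl fmx_mulDr.

Definition canon_idem (i : I) : fmx :=
  mkfmx (fun h k => if h == i then fm_delta h k else 0).

End FMData.

Record fmring (I : finType) := FMRing {
  fm_data :> fmdata I;
  fm_local : forall i, local_ring (corner fm_data i)
}.

Section Principal.
Variable R : pzRingType.

Fact right_principal_closed (x : R) :
  @submod_closed (R^c) ((R^c)^o) (fun y => `[< exists a : R, y = x * a >]).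
Proof.
split=> [|c y z /asboolP[a ->] /asboolP[b ->]]; apply/asboolP.
  by exists 0; rewrite mulr0.
exists (a * c + b); rewrite mulrDr mulrA; congr (_ + _).
Qed.

Fact left_principal_closed (x : R) :
  @submod_closed R (R^o) (fun y => `[< exists a : R, y = a * x >]).
Proof.
split=> [|c y z /asboolP[a ->] /asboolP[b ->]]; apply/asboolP.
  by exists 0; rewrite mul0r.
exists (c * a + b); rewrite mulrDl -mulrA; congr (_ + _).
Qed.

Definition right_principal (x : R) : lmodType (R^c) :=
  submod_type (Submod (right_principal_closed x)).
Definition left_principal (x : R) : lmodType R :=
  submod_type (Submod (left_principal_closed x)).

End Principal.

Section Nakayama.
Variables (I : finType) (S : fmring I).

Definition basic : Prop :=
  forall i j : I, i != j ->
    ~ mod_iso (right_principal (canon_idem S i)) (right_principal (canon_idem S j)).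

Definition nakayama_permutation (s : {perm I}) : Prop :=
  forall i : I,
    mod_iso (submod_type (socle (right_principal (canon_idem S i))))
            (top_mod (jacobson (fmx S) : {pred (fmx S)^c})
                     (right_principal (canon_idem S (s i))))
    /\
    mod_iso (submod_type (socle (left_principal (canon_idem S (s i)))))
            (top_mod (jacobson (fmx S)) (left_principal (canon_idem S i))).

Variable s : {perm I}.

Fact right_annihilated_closed (i : I) :
  @submod_closed _ (rbimod S i (s i))
    (fun m => `[< forall j, j != s i -> forall b : bimod S (s i) j,
                  fm_mul (m : bimod S i (s i)) b = 0 >]).
Proof.
split=> [|a m m' /asboolP hm /asboolP hm']; apply/asboolP=> j hj b.
  exact: fm_mul0l.
rewrite fm_mulDl hm' // addr0 -[LHS]fm_mulA; exact: hm.
Qed.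

Fact left_annihilated_closed (i : I) :
  @submod_closed _ (lbimod S i (s i))
    (fun m => `[< forall h, h != i -> forall b : bimod S h i,
                  fm_mul b (m : bimod S i (s i)) = 0 >]).
Proof.
split=> [|a m m' /asboolP hm /asboolP hm']; apply/asboolP=> j hj b.
  exact: fm_mul0r.
rewrite fm_mulDr hm' // addr0 [LHS]fm_mulA; exact: hm.
Qed.

(* T_{s(i)} and T'_i, as subsets of B_{i,s(i)} *)
Definition pairing_Tr (i : I) (m : bimod S i (s i)) : Prop :=
  exists2 u : submod_type (Submod (right_annihilated_closed i)),
    u \in socle (submod_type (Submod (right_annihilated_closed i))) &
    val u = m.

Definition pairing_Tl (i : I) (m : bimod S i (s i)) : Prop :=
  exists2 u : submod_type (Submod (left_annihilated_closed i)),
    u \in socle (submod_type (Submod (left_annihilated_closed i))) &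
    val u = m.

(* T'_i is isomorphic to K, as a bimodule over the corners at i and s(i) acting
   on K through the isomorphisms theta; g is the isomorphism K -> T'_i. *)
Definition pairing_Tl_iso (K : pzRingType)
    (theta : forall i, {rmorphism residue (corner S i) -> K}) (i : I) : Prop :=
  exists g : {additive K -> bimod S i (s i)},
    [/\ injective g,
        forall m, pairing_Tl m <-> exists x, g x = m,
        forall (a : corner S i) x,
          g (theta i (residue_pi a) * x) = fm_mul a (g x) &
        forall (b : corner S (s i)) x,
          g (x * theta (s i) (residue_pi b)) = fm_mul (g x) b].

End Nakayama.
Arguments pairing_Tr {I} S s i m.
Arguments pairing_Tl {I} S s i m.
Arguments pairing_Tl_iso {I} S s K theta i.

(* [fm_restrict S E] is e S e for e the sum of the e_i, i in E, as a formal matrix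
   ring; see canon_sum_peirce. *)
Section Restriction.
Variables (I : finType) (S : fmring I) (E : {set I}).

Definition fm_restrict_data : fmdata {i : I | i \in E} :=
  {| bimod := fun i j => bimod S (val i) (val j);
     fm_one := fun i => fm_one S (val i);
     fm_mul := fun i j k => @fm_mul _ S (val i) (val j) (val k);
     fm_mulDl := fun i j k => @fm_mulDl _ S (val i) (val j) (val k);
     fm_mulDr := fun i j k => @fm_mulDr _ S (val i) (val j) (val k);
     fm_mulA := fun i j k l => @fm_mulA _ S (val i) (val j) (val k) (val l);
     fm_mul1l := fun i j => @fm_mul1l _ S (val i) (val j);
     fm_mul1r := fun i j => @fm_mul1r _ S (val i) (val j) |}.

Definition fm_restrict : fmring {i : I | i \in E} :=
  @FMRing _ fm_restrict_data (fun i => fm_local S (val i)).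

Fact canon_sumE i j :
  entry (\sum_(h in E) canon_idem S h) i j = if i \in E then fm_delta S i j else 0.
Proof.
have -> : entry (\sum_(h in E) canon_idem S h) i j =
          \sum_(h in E) entry (canon_idem S h) i j.
  apply: (big_morph (fun A : fmx S => entry A i j)) => [A B|].
    exact: mkfmxE.
  exact: mkfmxE.
under eq_bigr do rewrite mkfmxE.
case: ifPn => iE; last first.
  by rewrite big1 // => h hE; case: eqP => // ih; rewrite ih hE in iE.
rewrite (bigD1 i) //= eqxx big1 ?addr0 // => h /andP[_ hi].
by rewrite eq_sym (negbTE hi).
Qed.

Fact canon_sum_mulE (A : fmx S) i j :
  entry ((\sum_(h in E) canon_idem S h) * A) i j =
  if i \in E then entry A i j else 0.
Proof.
rewrite [LHS]mkfmxE (bigD1 i) //= canon_sumE fm_delta_id big1 ?addr0.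
  by case: ifP => _; rewrite ?fm_mul1l ?fm_mul0l.
move=> k ki; rewrite canon_sumE fm_delta_neq 1?eq_sym // if_same.
exact: fm_mul0l.
Qed.

Fact mul_canon_sumE (A : fmx S) i j :
  entry (A * (\sum_(h in E) canon_idem S h)) i j =
  if j \in E then entry A i j else 0.
Proof.
rewrite [LHS]mkfmxE (bigD1 j) //= canon_sumE fm_delta_id big1 ?addr0.
  by case: ifP => _; rewrite ?fm_mul1r ?fm_mul0r.
move=> k kj; rewrite canon_sumE fm_delta_neq // if_same.
exact: fm_mul0r.
Qed.

Fact canon_sum_idem :
  (\sum_(h in E) canon_idem S h) * (\sum_(h in E) canon_idem S h) =
  \sum_(h in E) canon_idem S h.
Proof.
by apply: fmxP => i j; rewrite canon_sum_mulE canon_sumE; case: (i \in E).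
Qed.

Definition canon_sum : idem_elt (fmx S) := Idempotent canon_sum_idem.

Definition peirce_restrict (x : peirce canon_sum) : fmx fm_restrict :=
  @mkfmx _ fm_restrict (fun i j => entry (val x : fmx S) (val i) (val j)).

Definition fm_extend (A : fmx fm_restrict) : fmx S :=
  mkfmx (fun i j =>
    match @idP (i \in E), @idP (j \in E) with
    | ReflectT hi, ReflectT hj => entry A (exist _ i hi) (exist _ j hj)
    | _, _ => 0
    end).

Fact peirce_entry (x : peirce canon_sum) i j :
  entry (val x : fmx S) i j =
  if (i \in E) && (j \in E) then entry (val x : fmx S) i j else 0.
Proof.
rewrite -{1}(eqP (valP x)) mul_canon_sumE canon_sum_mulE.
by case: (i \in E); case: (j \in E).
Qed.

Fact fm_extendE A (i j : {i | i \in E}) :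
  entry (fm_extend A) (val i) (val j) = entry A i j.
Proof.
rewrite mkfmxE; case: i => i hi; case: j => j hj /=.
case: {-}_ / idP => // hi'; case: {-}_ / idP => // hj'.
by rewrite (bool_irrelevance hi' hi) (bool_irrelevance hj' hj).
Qed.

Fact fm_extend_out A i j :
  ~~ ((i \in E) && (j \in E)) -> entry (fm_extend A) i j = 0.
Proof.
move=> nE; rewrite mkfmxE; case: {-}_ / idP => // hi; case: {-}_ / idP => // hj.
by rewrite hi hj in nE.
Qed.

Lemma canon_sum_peirce : ring_iso (peirce canon_sum) (fmx fm_restrict).
Proof.
have gB : zmod_morphism peirce_restrict.
  by move=> x y; apply: fmxP => i j; rewrite !mkfmxE.
have gM : monoid_morphism peirce_restrict.
  split=> [|x y]; apply: fmxP => i j; rewrite !mkfmxE.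
    rewrite canon_sumE (valP i); have [->|ij] := eqVneq i j.
      by rewrite !fm_delta_id.
    by rewrite !fm_delta_neq.
  rewrite (bigID (mem E)) /= addrC big1 ?add0r => [|k kE]; last first.
    by rewrite peirce_entry (negbTE kE) andbF fm_mul0l.
  rewrite (reindex_omap val (insub : I -> option {i | i \in E})) => [|k kE].
    apply: eq_big => [k|k _]; last by rewrite !mkfmxE.
    by rewrite (valP k) valK eqxx.
  by rewrite insubT.
pose fA := GRing.isZmodMorphism.Build _ _ peirce_restrict gB.
pose fM := GRing.isMonoidMorphism.Build _ _ peirce_restrict gM.
pose f : {rmorphism peirce canon_sum -> fmx fm_restrict} :=
  HB.pack peirce_restrict fA fM.
have extP A : fm_extend A \in peirce_pred canon_sum.
  apply/eqP/fmxP => i j; rewrite mul_canon_sumE canon_sum_mulE.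
  have [|nE] := boolP ((i \in E) && (j \in E)); first by case/andP=> -> ->.
  by rewrite fm_extend_out // !if_same.
exists f; exists (fun A => exist _ (fm_extend A) (extP A)) => [x|A].
  apply: val_inj; apply: fmxP => i j; rewrite [RHS]peirce_entry /=.
  case: ifPn => [/andP[hi hj]|nE]; last exact: fm_extend_out.
  by rewrite -[i]/(val (Sub i hi : {i | i \in E}))
             -[j]/(val (Sub j hj : {i | i \in E})) fm_extendE mkfmxE.
by apply: fmxP => i j; rewrite [LHS]mkfmxE [LHS]fm_extendE.
Qed.

End Restriction.

Section Concat.
Variables (n n' : nat) (s : 'S_n) (s' : 'S_n').

Definition concat_fun (k : 'I_(n + n')) : 'I_(n + n') :=
  match split k with
  | inl i => lshift n' (s i)
  | inr j => rshift n (s' j)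
  end.

Fact concat_fun_inj : injective concat_fun.
Proof.
move=> k l; rewrite -[k]splitK -[l]splitK /concat_fun !unsplitK.
case: (split k) => i; case: (split l) => j /=.
- by move/lshift_inj/perm_inj ->.
- by move/eqP; rewrite eq_lrshift.
- by move/eqP; rewrite eq_rlshift.
- by move/rshift_inj/perm_inj ->.
Qed.

Definition concat_perm : 'S_(n + n') := perm concat_fun_inj.

End Concat.

(* Main.v *)
Require Import Defs.
From HB Require Import structures.
From mathcomp Require classical_sets.
From mathcomp Require Import functions.
From mathcomp Require Import all_boot perm all_algebra.
From mathcomp Require Import boolp.
Set Implicit Arguments.
Unset Strict Implicit.
Unset Printing Implicit Defensive.
Import GRing.Theory.
Local Open Scope ring_scope.

(** The ring R consists of the block matrices with the entries of S and S' in the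
    diagonal blocks, with entries in a K-L-bimodule X at the positions (i, j) with
    i in E and j in E', with entries in an L-K-bimodule Y at the transposed
    positions, and zero at the other positions outside of the diagonal blocks.
    The entries of S and S' act on X and Y through the residue skew fields of the
    corners.  The product of x in X at (i, j) and y in Y at (j, k) is zero unless
    k = sigma i; then it is the value p(x, y) in K of a pairing p of X and Y,
    moved to the simple socle T'_i, which is isomorphic to K.  Likewise for the
    products of Y and X, with a pairing q to L.

    Associativity ([glue_data]) comes from the bilinearity of p and q and the
    bimodule isomorphisms of T'_i with K, apart from the products x y x', which
    have to be zero.  They are zero because T'_i is in the radical: a corner with
    a socle element outside its radical is a skew field, while the corners of
    e S e at the fixed points of rho are not simple ([residue_socle_entry]).  The socle T'_i refers to e S e only, but it is
    one-dimensional over K and contains a generator of the socle of a row and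
    of a column of S; so it is killed by the radical of S on both sides
    ([pairing_embed_left_socle], [pairing_embed_right_socle]).

    If p and q are nondegenerate on both sides, no nonzero element of X or Y is
    in a socle, since it has a nonzero product with an element of the radical;
    and the socle elements of S and S' are killed by X and Y.  So the socles of R
    are those of S and S', which gives the Nakayama permutation and the
    statement on essential socles ([glue_nakayama], [glue_essential]).  A
    central idempotent of R is diagonal with entries 0 and 1, constant on each of
    the indecomposable blocks, and a nonzero element of X forces the two constants
    to agree ([glue_connected]).

    The remaining point is to find X and Y with two such pairings
    ([exists_double_pairing]).  A K-L-bimodule structure on K amounts to a ring
    morphism L -> K.  Let F be the subfield of the center of L that it maps to the
    center of K.  Then X = K (x)_F L and Y = L (x)_F K serve: nonzero F-linear
    forms lam on L and mu on K, which exist by Zorn's lemma, contract the two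
    inner factors of k (x) l (x) l' (x) k' to k lam(l l') k', and those of
    l (x) k (x) k' (x) l' to l mu(k k') l'.

    All module-theoretic conditions are first translated into conditions on the
    entries of the matrices ([basicP], [nakayama_permutationP],
    [essential_right_socleP], [indecomposable_fmxP]), using that the Jacobson
    radical consists of the matrices with entries in the radical
    ([jacobson_fmxP]) and that the socle of a module is the annihilator of the
    radical ([socleP]). *)

(** * Maximal submodules, local rings and linear forms *)

Section AvoidingSubmodule.
Variables (R : pzRingType) (M : lmodType R).

Lemma chain_union_closed (N0 : submod M) (C : submod M -> Prop) :
  (forall N N', C N -> C N' -> {subset N <= N'} \/ {subset N' <= N}) ->
  @submod_closed R M
    (fun x => `[< x \in N0 \/
       exists2 N : submod M, C N /\ {subset N0 <= N} & x \in N >]).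
Proof.
move=> tot; split=> [|a u v /asboolP hu /asboolP hv]; apply/asboolP.
  by left; apply: rpred0.
case: hu hv => [hu|[N [hN sN] hu]] [hv|[N' [hN' sN'] hv]].
- by left; apply: rpredD => //; apply: rpredZ.
- by right; exists N' => //; apply: rpredD => //; apply: rpredZ; apply: sN'.
- by right; exists N => //; apply: rpredD; [apply: rpredZ | apply: sN].
case: (tot _ _ hN hN') => s; right.
  by exists N' => //; apply: rpredD => //; apply: rpredZ; apply: s.
by exists N => //; apply: rpredD; [apply: rpredZ | apply: s].
Qed.

(** The union of a chain of submodules which miss [v] misses [v]. *)
Lemma exists_maximal_avoiding (v : M) (N0 : submod M) : v \notin N0 ->
  exists N : submod M, [/\ {subset N0 <= N}, v \notin N &
    forall N' : submod M, {subset N <= N'} -> v \notin N' -> {subset N' <= N}].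
Proof.
move=> vN0.
pose good (N : submod M) := `[< {subset N0 <= N} /\ v \notin N >].
pose T := {N : submod M | good N}.
pose leT (N N' : T) := `[< {subset sval N <= sval N'} >].
have good0 : good N0 by apply/asboolP; split.
have [||C totC|[N gN] maxN] :=
    @classical_sets.ZL_preorder T (exist _ N0 good0) leT.
- by move=> N; apply/asboolP.
- by move=> N1 N2 N3 /asboolP s /asboolP s'; apply/asboolP => x /s /s'.
- pose D (N : submod M) := exists2 N1 : T, C N1 & sval N1 = N.
  have totD : forall N N', D N -> D N' -> {subset N <= N'} \/ {subset N' <= N}.
    move=> _ _ [N1 h1 <-] [N2 h2 <-].
    by have [/asboolP|/asboolP] := totC _ _ h1 h2; [left | right].
  pose U := Submod (chain_union_closed N0 totD).
  have gU : good U.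
    apply/asboolP; split=> [x hx|]; first by apply/asboolP; left.
    apply/negP => /asboolP[|[_ [[[N gN] _ <-] _]]] /=; first exact/negP.
    by move/asboolP: gN => [_ /negP].
  exists (exist _ U gU) => N1 CN; apply/asboolP => x /= xN; apply/asboolP.
  right; exists (sval N1) => //; split; first by exists N1.
  by move/asboolP: (svalP N1) => [].
move/asboolP: (gN) => [sN vN]; exists N; split=> // N' sN' vN'.
have gN' : good N' by apply/asboolP; split=> // x /sN; apply: sN'.
by have /asboolP := maxN (exist _ N' gN') (introT (asboolP _) sN').
Qed.

End AvoidingSubmodule.

Lemma exists_maximal_left_ideal (R : pzRingType) (N0 : submod R^o) :
  (1 : R) \notin N0 ->
  exists2 m : submod R^o, {subset N0 <= m} & maximal_submod m.
Proof.
move=> /exists_maximal_avoiding[m [sm m1 maxm]]; exists m => //.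
split; first by exists 1.
move=> N' sN'; have [N1|/(maxm _ sN')] := boolP ((1 : R^o) \in N'); last by left.
by right=> x; rewrite -[x]mulr1; apply: (@rpredZ _ R^o N').
Qed.

Definition left_ideal_of (R : pzRingType) (x : R) : submod R^o :=
  Submod (left_principal_closed x).

Lemma jacobson_1B (R : pzRingType) (x : R) :
  x \in jacobson R -> exists y, y * (1 - x) = 1.
Proof.
move=> /asboolP hx; apply: contrapT => nu.
have [|m sm maxm] := @exists_maximal_left_ideal R (left_ideal_of (1 - x)).
  by apply/negP => /asboolP[y yE]; apply: nu; exists y.
have [y /negP[]] := maxm.1.
suff m1 : (1 : R^o) \in m by rewrite -[y]mulr1; apply: (@rpredZ _ R^o m).
rewrite -[1](subrK (x : R^o)); apply: rpredD; last exact: hx.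
by apply: sm; apply/asboolP; exists 1; rewrite mul1r.
Qed.

Section LocalRing.
Variables (R : pzRingType) (locR : local_ring R).

Lemma local_neq0 : (1 : R) != 0.
Proof.
have [m [[x xm] _] _] := locR; apply: contraNneq xm => h.
by rewrite -[x](mulr1 (x : R)) h mulr0; apply: rpred0.
Qed.

Lemma local_1_notin_jacobson : (1 : R) \notin jacobson R.
Proof.
apply/negP => /jacobson_1B[y]; rewrite subrr mulr0 => h.
by have /eqP[] := local_neq0.
Qed.

(** Otherwise [R x] would lie in a maximal left ideal, hence in the only one. *)
Lemma local_left_inverse (x : R) : x \notin jacobson R -> exists y, y * x = 1.
Proof.
move=> nx; apply: contrapT => nu; case/negP: nx.
have [|m sm maxm] := @exists_maximal_left_ideal R (left_ideal_of x).
  by apply/negP => /asboolP[y yE]; apply: nu; exists y.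
have [m0 max0 uniq0] := locR.
apply/asboolP => m' maxm'; rewrite (uniq0 _ maxm') -(uniq0 _ maxm).
by apply: sm; apply/asboolP; exists 1; rewrite mul1r.
Qed.

Lemma local_unit (x : R) :
  x \notin jacobson R -> exists y, y * x = 1 /\ x * y = 1.
Proof.
move=> /local_left_inverse[y yx].
have [|z zy] := @local_left_inverse y.
  apply/negP => /(fun h => jacobsonMr x h); rewrite yx.
  exact/negP/local_1_notin_jacobson.
exists y; split=> //; suff -> : x = z by [].
by rewrite -[z]mulr1 -yx mulrA zy mul1r.
Qed.

Lemma local_jacobsonP (x : R) : x \in jacobson R <-> forall y, x * y <> 1.
Proof.
split=> [hx y xy|h].
  by move: (jacobsonMr y hx); rewrite xy; apply/negP/local_1_notin_jacobson.
apply: contrapT => /negP /local_unit[y [_ xy]]; exact: (h y).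
Qed.

Lemma local_idempotent (x : R) : x * x = x -> x = 0 \/ x = 1.
Proof.
move=> xx; have [hx|/local_unit[y [yx _]]] := boolP (x \in jacobson R).
  have [y y1] := jacobson_1B hx; left.
  by rewrite -[x]mul1r -y1 -mulrA mulrBl mul1r xx subrr mulr0.
by right; rewrite -[x]mul1r -{1}yx -mulrA xx.
Qed.

(** A local ring without radical is a skew field. *)
Lemma local_simple : (forall x : R, x \in jacobson R -> x = 0) -> simple_ring R.
Proof.
move=> J0; split; first exact: local_neq0.
move=> I _; have [[x xI x0]|h] := pselect (exists2 x, x \in I & x <> 0); last first.
  by left=> x xI; apply: contrapT => x0; apply: h; exists x.
right=> y; have [|z [zx _]] := @local_unit x; first by apply/negP => /J0.
by rewrite -[y]mulr1 -zx mulrA; apply: (@rpredZ _ R^o I).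
Qed.

End LocalRing.

(** The kernel is a maximal subspace missing [v], so that every vector is the
    sum of a vector of the kernel and of a multiple of [v]. *)
Lemma exists_linear_form (F : pzRingType) (V : lmodType F) (v : V) :
  skew_field F -> v != 0 ->
  exists f : V -> F, [/\ forall x y, f (x + y) = f x + f y,
    forall c x, f (c *: x) = c * f x & f v = 1].
Proof.
move=> [F1 Finv] v0.
have zcl : @submod_closed F V (fun x => x == 0).
  by split=> [|a x y /eqP-> /eqP->]; rewrite /in_mem /= ?scaler0 ?addr0 eqxx.
have [|N [_ vN maxN]] := @exists_maximal_avoiding F V v (Submod zcl).
  by [].
have dec x : exists c, x - c *: v \in N.
  have [xN|xN] := boolP (x \in N).
    by exists 0; rewrite scale0r subr0.
  have acl : @submod_closed F V
      (fun y => `[< exists2 u, u \in N & exists b : F, y = u + b *: x >]).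
    split=> [|a y z /asboolP[u hu [b ->]] /asboolP[w hw [c ->]]]; apply/asboolP.
      by exists 0; [apply: rpred0 | exists 0; rewrite scale0r addr0].
    exists (a *: u + w); first by apply: rpredD => //; apply: rpredZ.
    by exists (a * b + c); rewrite scalerDr scalerDl scalerA addrACA.
  have [/asboolP[u hu [b vE]]|nv] := boolP (v \in Submod acl).
    have [b0|/Finv[c [cb _]]] := eqVneq b 0.
      by move: vN; rewrite vE b0 scale0r addr0 hu.
    exists c; rewrite vE scalerDr scalerA cb scale1r opprD addrCA subrr addr0.
    by rewrite -scalerN -scaleN1r scalerA; apply: rpredZ.
  case/negP: xN; apply: (maxN (Submod acl)) => //.
    move=> u hu; apply/asboolP; exists u => //; exists 0.
    by rewrite scale0r addr0.
  by apply/asboolP; exists 0; [apply: rpred0 | exists 1; rewrite scale1r add0r].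
have uniq_c (c c' : F) x : x - c *: v \in N -> x - c' *: v \in N -> c = c'.
  move=> h h'; apply/eqP; rewrite -subr_eq0; apply: contraNT vN.
  move=> /Finv[d [dc _]]; rewrite -[v]scale1r -dc -scalerA; apply: rpredZ.
  have -> : (c - c') *: v = (x - c' *: v) + -1 *: (x - c *: v).
    by rewrite scaleN1r opprB [RHS]addrC addrA subrK scalerBl.
  by apply: rpredD => //; apply: rpredZ.
pose f x := projT1 (cid (dec x)).
have fN x : x - f x *: v \in N by rewrite /f; case: cid.
exists f; split=> [x y|c x|].
- apply: (uniq_c _ _ (x + y)); first exact: fN.
  by rewrite scalerDl opprD addrACA; apply: rpredD; apply: fN.
- apply: (uniq_c _ _ (c *: x)); first exact: fN.
  by rewrite -scalerA -scalerBr; apply: rpredZ; apply: fN.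
- by apply: (uniq_c _ _ v); rewrite ?fN // scale1r subrr rpred0.
Qed.

(** * Bimodules over skew fields with nondegenerate pairings on both sides *)

Record bimodule (K L : pzRingType) := Bimodule {
  bm_car :> zmodType;
  bm_l : K -> bm_car -> bm_car;
  bm_r : bm_car -> L -> bm_car;
  bm_lDl : forall a b x, bm_l (a + b) x = bm_l a x + bm_l b x;
  bm_lDr : forall a x y, bm_l a (x + y) = bm_l a x + bm_l a y;
  bm_lM : forall a b x, bm_l (a * b) x = bm_l a (bm_l b x);
  bm_l1 : forall x, bm_l 1 x = x;
  bm_rDl : forall x y a, bm_r (x + y) a = bm_r x a + bm_r y a;
  bm_rDr : forall x a b, bm_r x (a + b) = bm_r x a + bm_r x b;
  bm_rM : forall x a b, bm_r x (a * b) = bm_r (bm_r x a) b;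
  bm_r1 : forall x, bm_r x 1 = x;
  bm_lr : forall a x b, bm_l a (bm_r x b) = bm_r (bm_l a x) b
}.

(** Nondegeneracy is required on both sides: [X] and [Y] are going to be
    coordinate bimodules, and they should not contribute to the socles of the rows,
    nor to those of the columns. *)
Record pairing (K L : pzRingType) (X : bimodule K L) (Y : bimodule L K) := Pairing {
  pair_fun :> X -> Y -> K;
  pairDl : forall x x' y, pair_fun (x + x') y = pair_fun x y + pair_fun x' y;
  pairDr : forall x y y', pair_fun x (y + y') = pair_fun x y + pair_fun x y';
  pairZl : forall a x y, pair_fun (bm_l a x) y = a * pair_fun x y;
  pairZr : forall x y a, pair_fun x (bm_r y a) = pair_fun x y * a;
  pair_mid : forall x a y, pair_fun (bm_r x a) y = pair_fun x (bm_l a y);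
  pair_ndl : forall x, x != 0 -> exists y, pair_fun x y != 0;
  pair_ndr : forall y, y != 0 -> exists x, pair_fun x y != 0
}.

(** As the image of [F] is central, [(x, y) |-> mu (x y)] is bilinear for all
    the actions of [F]; if [K] is a skew field, it is nondegenerate. *)
Record central_form (F K : pzRingType) (b : {rmorphism F -> K}) (mu : K -> F) :
    Prop := CentralForm {
  cf_comm : forall c x, b c * x = x * b c;
  cf_inj : injective b;
  cfD : forall x y, mu (x + y) = mu x + mu y;
  cfZ : forall c x, mu (b c * x) = c * mu x;
  cf_neq0 : exists x, mu x != 0
}.

Section CentralForm.
Variables (F K : pzRingType) (b : {rmorphism F -> K}) (mu : K -> F).
Hypothesis (form : central_form b mu).

Lemma cf0 : mu 0 = 0.
Proof. by apply: (addIr (mu 0)); rewrite -(cfD form) !add0r. Qed.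

Lemma cf_sum (I : Type) (s : seq I) (f : I -> K) :
  mu (\sum_(i <- s) f i) = \sum_(i <- s) mu (f i).
Proof. exact: (big_morph mu (cfD form) cf0). Qed.

Lemma cf_base_comm (c d : F) : c * d = d * c.
Proof. by apply: (cf_inj form); rewrite !rmorphM (cf_comm form). Qed.

Lemma cf_nondeg (z : K) : skew_field K -> (forall h, mu (z * h) = 0) -> z = 0.
Proof.
move=> [_ inv] h; apply/eqP/negPn/negP => /inv[y [_ zy]].
by have [x /eqP[]] := cf_neq0 form; rewrite -[x]mul1r -zy -mulrA h.
Qed.

Lemma cf_nondeg_r (z : K) : skew_field K -> (forall h, mu (h * z) = 0) -> z = 0.
Proof.
move=> [_ inv] h; apply/eqP/negPn/negP => /inv[y [yz _]].
by have [x /eqP[]] := cf_neq0 form; rewrite -[x]mulr1 -yz mulrA h.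
Qed.

End CentralForm.

(** The tensors in K (x)_F L, seen as functions L -> K: the form [lam] turns the
    element k (x) l into the function m |-> k lam(l m).  If L is a skew field, this
    embeds the tensor product, since [(l, m) |-> lam (l m)] is nondegenerate. *)
Section Tensor.
Variables (F K L : pzRingType) (b : {rmorphism F -> K}) (lam : L -> F).

Definition tensor_fun (s : seq (K * L)) : L -> K :=
  fun m => \sum_(u <- s) u.1 * b (lam (u.2 * m)).

Definition tensor_pred : {pred (L -> K)} :=
  fun x => `[< exists s, x = tensor_fun s >].

Fact tensor_closed : zmod_closed tensor_pred.
Proof.
split=> [|x y /asboolP[s ->] /asboolP[t ->]]; apply/asboolP.
  by exists [::]; apply/funext => m; rewrite /tensor_fun big_nil.
exists (s ++ [seq (- u.1, u.2) | u <- t]); apply/funext => m.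
transitivity (tensor_fun s m - tensor_fun t m); first by [].
rewrite /tensor_fun big_cat big_map /= -sumrN; congr (_ + _).
by apply: eq_bigr => u _; rewrite mulNr.
Qed.

Definition tensor : Type := {x : L -> K | x \in tensor_pred}.
HB.instance Definition _ := SubChoice.on tensor.
HB.instance Definition _ := GRing.isZmodClosed.Build _ tensor_pred tensor_closed.
HB.instance Definition _ :=
  GRing.SubChoice_isSubZmodule.Build _ _ tensor tensor_closed.

Definition mk_tensor (s : seq (K * L)) : tensor :=
  exist _ (tensor_fun s) (introT (asboolP _) (ex_intro _ s erefl)).

Lemma tensorP (x : tensor) : exists s, x = mk_tensor s.
Proof. by have /asboolP[s xE] := valP x; exists s; apply: val_inj. Qed.

Fact tensor_l_subproof (a : K) (x : tensor) :
  (fun m => a * val x m) \in tensor_pred.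
Proof.
have [s ->] := tensorP x; apply/asboolP; exists [seq (a * u.1, u.2) | u <- s].
apply/funext => m; rewrite /= /tensor_fun big_map mulr_sumr.
by apply: eq_bigr => u _; rewrite mulrA.
Qed.

Fact tensor_r_subproof (x : tensor) (a : L) :
  (fun m => val x (a * m)) \in tensor_pred.
Proof.
have [s ->] := tensorP x; apply/asboolP; exists [seq (u.1, u.2 * a) | u <- s].
apply/funext => m; rewrite /= /tensor_fun big_map.
by apply: eq_bigr => u _; rewrite mulrA.
Qed.

Definition tensor_l a x :
  tensor := exist (fun f => f \in tensor_pred) _ (tensor_l_subproof a x).
Definition tensor_r x a :
  tensor := exist (fun f => f \in tensor_pred) _ (tensor_r_subproof x a).

Lemma tensor_ext (x y : tensor) : (forall m, val x m = val y m) -> x = y.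
Proof. by move=> h; apply: val_inj; apply/funext. Qed.

Hypothesis lamD : forall x y, lam (x + y) = lam x + lam y.

Lemma val_tensorD (x : tensor) l m : val x (l + m) = val x l + val x m.
Proof.
have [s ->] := tensorP x; rewrite /= /tensor_fun -big_split /=.
by apply: eq_bigr => u _; rewrite mulrDr lamD rmorphD mulrDr.
Qed.

Definition tensor_bimodule : bimodule K L.
Proof.
refine (@Bimodule K L tensor tensor_l tensor_r _ _ _ _ _ _ _ _ _).
- by move=> a c x; apply: tensor_ext => m /=; rewrite mulrDl.
- by move=> a x y; apply: tensor_ext => m /=; rewrite -mulrDr.
- by move=> a c x; apply: tensor_ext => m /=; rewrite mulrA.
- by move=> x; apply: tensor_ext => m /=; rewrite mul1r.
- by move=> x y a; apply: tensor_ext.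
- by move=> x a c; apply: tensor_ext => m /=; rewrite mulrDl val_tensorD.
- by move=> x a c; apply: tensor_ext => m /=; rewrite mulrA.
- by move=> x; apply: tensor_ext => m /=; rewrite mul1r.
- by move=> a x c; apply: tensor_ext.
Defined.

End Tensor.

Section TensorPairing.
Variables (F K L : pzRingType) (b : {rmorphism F -> K}) (a : {rmorphism F -> L}).
Variables (mu : K -> F) (lam : L -> F).
Hypotheses (K_skew : skew_field K) (L_skew : skew_field L).
Hypotheses (form_mu : central_form b mu) (form_lam : central_form a lam).

Let X := tensor b lam.
Let Y := tensor a mu.

Definition tensor_rep (y : Y) : seq (L * K) := projT1 (cid (tensorP y)).

Definition tensor_pair (x : X) (y : Y) : K :=
  \sum_(v <- tensor_rep y) val x v.1 * v.2.

Definition tensor_adj (y : Y) (m : L) : K :=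
  \sum_(v <- tensor_rep y) b (lam (m * v.1)) * v.2.

Lemma tensor_repK y : y = mk_tensor a mu (tensor_rep y).
Proof. by rewrite /tensor_rep; case: cid. Qed.

(** [tensor_adj y] is adjoint to the function [y] for the forms [mu] and [lam],
    and it is determined by this property; so it depends on the function [y]
    only and not on the chosen representation of [y] as a sum. *)
Lemma tensor_adjP y m h : mu (tensor_adj y m * h) = lam (m * val y h).
Proof.
rewrite [in RHS](tensor_repK y) /= /tensor_fun /tensor_adj.
rewrite mulr_suml mulr_sumr (cf_sum form_mu) (cf_sum form_lam).
apply: eq_bigr => v _; rewrite -mulrA (cfZ form_mu).
by rewrite mulrA -(cf_comm form_lam) (cfZ form_lam) (cf_base_comm form_mu).
Qed.

Lemma tensor_adj_uniq y m z :
  (forall h, mu (z * h) = lam (m * val y h)) -> tensor_adj y m = z.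
Proof.
move=> hz; apply/eqP; rewrite -subr_eq0; apply/eqP.
apply: (cf_nondeg form_mu K_skew) => h; apply: (addIr (mu (z * h))).
by rewrite -(cfD form_mu) mulrBl subrK add0r tensor_adjP hz.
Qed.

Lemma tensor_pair_adj (s : seq (K * L)) y :
  tensor_pair (mk_tensor b lam s) y = \sum_(u <- s) u.1 * tensor_adj y u.2.
Proof.
rewrite /tensor_pair /= /tensor_fun /tensor_adj.
under eq_bigr do rewrite mulr_suml.
rewrite exchange_big; apply: eq_bigr => u _; rewrite mulr_sumr.
by apply: eq_bigr => v _; rewrite mulrA.
Qed.

Lemma tensor_pair1 (k : K) (m : L) y :
  tensor_pair (mk_tensor b lam [:: (k, m)]) y = k * tensor_adj y m.
Proof. by rewrite tensor_pair_adj big_seq1. Qed.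

Lemma tensor_adj_mk s m :
  tensor_adj (mk_tensor a mu s) m = \sum_(v <- s) b (lam (m * v.1)) * v.2.
Proof.
apply: tensor_adj_uniq => h; rewrite /= /tensor_fun mulr_suml mulr_sumr.
rewrite (cf_sum form_mu) (cf_sum form_lam).
apply: eq_bigr => v _; rewrite -mulrA (cfZ form_mu).
by rewrite mulrA -(cf_comm form_lam) (cfZ form_lam) (cf_base_comm form_mu).
Qed.

Lemma tensor_pair_rep (x : X) s :
  tensor_pair x (mk_tensor a mu s) = \sum_(v <- s) val x v.1 * v.2.
Proof.
have [t ->] := tensorP x; rewrite tensor_pair_adj /= /tensor_fun.
under eq_bigr do rewrite tensor_adj_mk mulr_sumr.
rewrite exchange_big; apply: eq_bigr => v _; rewrite mulr_suml.
by apply: eq_bigr => u _; rewrite mulrA.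
Qed.

Definition tensor_pairing :
  pairing (tensor_bimodule b (cfD form_lam)) (tensor_bimodule a (cfD form_mu)).
Proof.
refine (@Pairing K L (tensor_bimodule b (cfD form_lam))
  (tensor_bimodule a (cfD form_mu)) tensor_pair _ _ _ _ _ _ _).
- by move=> x x' y; rewrite /tensor_pair -big_split /=; apply: eq_bigr => v _;
    rewrite -mulrDl.
- move=> x y y'; have [s ->] := tensorP x; rewrite !tensor_pair_adj -big_split /=.
  apply: eq_bigr => u _; rewrite -mulrDr; congr (_ * _).
  apply: tensor_adj_uniq => h.
  by rewrite mulrDl (cfD form_mu) !tensor_adjP -(cfD form_lam) -mulrDr.
- move=> c x y; rewrite /tensor_pair mulr_sumr.
  by apply: eq_bigr => v _; rewrite mulrA.
- move=> x y c; have [s ->] := tensorP x; rewrite !tensor_pair_adj mulr_suml.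
  apply: eq_bigr => u _; rewrite -mulrA; congr (_ * _).
  by apply: tensor_adj_uniq => h; rewrite -mulrA tensor_adjP.
- move=> x c y; have [s ->] := tensorP y.
  have -> : bm_l c (mk_tensor a mu s : tensor_bimodule a (cfD form_mu)) =
            mk_tensor a mu [seq (c * v.1, v.2) | v <- s].
    apply: tensor_ext => m; rewrite /= /tensor_fun big_map mulr_sumr.
    by apply: eq_bigr => v _; rewrite mulrA.
  by rewrite !tensor_pair_rep big_map.
- move=> x x0; have [h|m] := pselect (forall m, val x m = 0).
    by case/eqP: x0; apply: tensor_ext.
  have [m' hm] : exists m', val x m' != 0.
    by apply: contrapT => h; apply: m => m'; apply/eqP/negPn/negP => h'; apply: h; exists m'.
  exists (mk_tensor a mu [:: (m', 1)]).
  by rewrite tensor_pair_rep big_seq1 mulr1.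
- move=> y y0; have [h|m] := pselect (forall m, tensor_adj y m = 0).
    case/eqP: y0; apply: tensor_ext => k.
    apply: (cf_nondeg_r form_lam L_skew) => m.
    by rewrite -tensor_adjP h mul0r (cf0 form_mu).
  have [m' hm] : exists m', tensor_adj y m' != 0.
    apply: contrapT => h; apply: m => m'; apply/eqP/negPn/negP => h'.
    by apply: h; exists m'.
  exists (mk_tensor b lam [:: (1, m')]).
  by rewrite tensor_pair1 mul1r.
Defined.

Lemma tensor_bimodule_neq0 (K1 : (1 : K) != 0) :
  exists x : tensor_bimodule b (cfD form_lam), x != 0.
Proof.
have [m hm] := cf_neq0 form_lam.
exists (mk_tensor b lam [:: (1, 1)]); apply: contraNneq hm => h0.
have /(congr1 (fun x : tensor b lam => val x m)) /= := h0.
rewrite /tensor_fun big_seq1 /= !mul1r => h1.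
by apply/eqP/(cf_inj form_mu); rewrite rmorph0.
Qed.

End TensorPairing.
Section CommonCenter.
Variables (K L : nzRingType) (phi : {rmorphism L -> K}).

(** The subfield of the center of [L] which [phi] maps to the center of [K];
    the tensor product over it carries central actions on both sides. *)
Definition common_center_pred : {pred L} :=
  fun c => `[< (forall x, c * x = x * c) /\ (forall y, phi c * y = y * phi c) >].

Fact common_center_closed : subring_closed common_center_pred.
Proof.
split=> [|c d /asboolP[hc hc'] /asboolP[hd hd']|c d /asboolP[hc hc'] /asboolP[hd hd']];
  apply/asboolP; split=> x.
- by rewrite mul1r mulr1.
- by rewrite rmorph1 mul1r mulr1.
- by rewrite mulrBl mulrBr hc hd.
- by rewrite rmorphB mulrBl mulrBr hc' hd'.
- by rewrite -mulrA hd mulrA hc mulrA.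
- by rewrite rmorphM -mulrA hd' mulrA hc' mulrA.
Qed.

Definition common_center : Type := {c : L | c \in common_center_pred}.
HB.instance Definition _ := SubChoice.on common_center.
HB.instance Definition _ :=
  GRing.SubChoice_isSubPzRing.Build L _ common_center common_center_closed.

Let F : pzRingType := common_center.
Let a : {rmorphism F -> L} := val.
Let b : {rmorphism F -> K} := phi \o a.

Lemma inverse_central (R : pzRingType) (c d : R) : d * c = 1 -> c * d = 1 ->
  (forall x, c * x = x * c) -> forall x, d * x = x * d.
Proof.
move=> dc cd hc x.
by rewrite -[RHS]mul1r -dc !mulrA -[d * c * x]mulrA hc -!mulrA cd mulr1.
Qed.

Lemma common_center_skew : skew_field L -> skew_field F.
Proof.
move=> [L1 inv]; split; first by rewrite -val_eqE /= oner_eq0.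
move=> c; rewrite -val_eqE /= => /inv[d [dc cd]].
have dF : d \in common_center_pred.
  have /asboolP[hc hc'] := valP c; apply/asboolP; split.
    exact: (inverse_central dc cd hc).
  by apply: (inverse_central _ _ hc'); rewrite -rmorphM ?dc ?cd rmorph1.
by exists (Sub d dF); split; apply: val_inj; rewrite /= ?dc ?cd.
Qed.

Lemma exists_central_form (R : nzRingType) (f : {rmorphism F -> R}) :
  skew_field F -> (forall c x, f c * x = x * f c) ->
  exists mu : R -> F, central_form f mu.
Proof.
move=> F_skew fc.
pose m := @GRing.Zmodule_isLmodule.Build F R (fun c x => f c * x)
  (fun c d x => eq_ind_r (fun z => _ = z * x) (mulrA _ _ _) (rmorphM f c d))
  (fun x => eq_ind_r (fun z => z * x = x) (mul1r x) (rmorph1 f))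
  (fun c x y => mulrDr _ x y)
  (fun x c d => eq_ind_r (fun z => z * x = _) (mulrDl _ _ _) (rmorphD f c d)).
pose M : lmodType F := HB.pack R m.
have [mu [muD muZ mu1]] := @exists_linear_form F M (1 : R) F_skew (oner_neq0 R).
exists mu; split=> //; last first.
  by exists 1; rewrite mu1; case: F_skew.
move=> c d /eqP; rewrite -subr_eq0 -rmorphB => /eqP h; apply/eqP.
rewrite -subr_eq0; apply/negPn/negP => /F_skew.2[e [ec _]].
have := rmorph1 f; rewrite -ec rmorphM h mulr0 => /eqP.
by rewrite eq_sym oner_eq0.
Qed.

(** The bimodules are K (x)_F L and L (x)_F K for the common center F.  Both
    pairings are instances of the same construction, as it is symmetric in the
    two skew fields and their forms. *)
Lemma exists_double_pairing : skew_field K -> skew_field L ->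
  exists (X : bimodule K L) (Y : bimodule L K) (p : pairing X Y) (q : pairing Y X),
    exists x : X, x != 0.
Proof.
move=> K_skew L_skew; have F_skew := common_center_skew L_skew.
have [|mu form_mu] := exists_central_form (f := b) F_skew.
  by move=> c x; have /asboolP[_ ->] := valP c.
have [|lam form_lam] := exists_central_form (f := a) F_skew.
  by move=> c x; have /asboolP[-> _] := valP c.
exists (tensor_bimodule b (cfD form_lam)), (tensor_bimodule a (cfD form_mu)).
exists (tensor_pairing K_skew L_skew form_mu form_lam).
exists (tensor_pairing L_skew K_skew form_lam form_mu).
exact: tensor_bimodule_neq0 form_mu form_lam (oner_neq0 K).
Qed.

End CommonCenter.

(** A K-L-bimodule structure on K is determined by the map l |-> 1 l, which is
    a ring morphism L -> K. *)
Lemma admits_bimodule_morphism (K L : nzRingType) :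
  admits_bimodule K L -> exists phi : {rmorphism L -> K}, True.
Proof.
move=> [r [rDl rDr r1 rM] rl]; pose phi l := r 1 l.
have phiE x l : r x l = x * phi l by rewrite -rl mulr1.
have phiD : zmod_morphism phi.
  move=> x y; apply: (addIr (phi y)); rewrite subrK /phi.
  by rewrite -rDr subrK.
have phiM : monoid_morphism phi.
  by split=> [|x y]; rewrite /phi ?r1 // rM phiE.
pose fA := GRing.isZmodMorphism.Build _ _ phi phiD.
pose fM := GRing.isMonoidMorphism.Build _ _ phi phiM.
pose f : {rmorphism L -> K} := HB.pack phi fA fM.
by exists f.
Qed.
(** * Socles and tops over a ring which is basic modulo its radical *)

(** The properties shared by a local ring, by a basic formal matrix ring and by
    its converse: modulo the ideal [J] the ring is a product of skew fields, with
    the units of the factors lifted to the orthogonal idempotents [e i]. *)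
Record basic_frame (A : pzRingType) (I : finType) (e : I -> A) (J : {pred A}) :
    Prop := BasicFrame {
  frame0 : 0 \in J;
  frameD : forall x y, x \in J -> y \in J -> x + y \in J;
  frameMl : forall a x, x \in J -> a * x \in J;
  frameMr : forall a x, x \in J -> x * a \in J;
  frame_idem : forall i, e i * e i = e i;
  frame_sum : \sum_i e i = 1;
  frame_notin : forall i, e i \notin J;
  frame_off : forall i j a, i != j -> e i * a * e j \in J;
  frame_unit : forall i a, e i * a * e i \notin J ->
    exists b, b * (e i * a * e i) = e i
}.

Section Frame.
Variables (A : pzRingType) (I : finType) (e : I -> A) (J : {pred A}).
Hypothesis (fr : basic_frame e J).

Lemma val_scale_eq0 (M : lmodType A) (N : submod M) a (x : submod_type N) :
  a *: x = 0 <-> a *: val x = 0.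
Proof.
rewrite -GRing.valZ; split=> [->|h]; first exact: raddf0.
by apply: val_inj; rewrite h raddf0.
Qed.

Section FrameModule.
Variable M : lmodType A.

Fact cyclic_closed (x : M) :
  @submod_closed A M (fun y => `[< exists a, y = a *: x >]).
Proof.
split=> [|c y z /asboolP[a ->] /asboolP[b ->]]; apply/asboolP.
  by exists 0; rewrite scale0r.
by exists (c * a + b); rewrite scalerDl scalerA.
Qed.

Definition cyclic (x : M) : submod M := Submod (cyclic_closed x).

Lemma cyclic_id (x : M) : x \in cyclic x.
Proof. by apply/asboolP; exists 1; rewrite scale1r. Qed.

Fact annihilated_closed :
  @submod_closed A M (fun x => `[< forall a, a \in J -> a *: x = 0 >]).
Proof.
split=> [|c y z /asboolP hy /asboolP hz]; apply/asboolP => a aJ.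
  by rewrite scaler0.
by rewrite scalerDr scalerA hy ?hz ?addr0 //; apply: (frameMr fr).
Qed.

Lemma scale_frame_sum (x : M) : x = \sum_i e i *: x.
Proof. by rewrite -scaler_suml (frame_sum fr) scale1r. Qed.

(** If [w] in [e i M] is a multiple of [a w] with [a] in [J], say [w = c a w],
    then [e i - e i c a e i] kills [w]; it has a left inverse in [e i A e i]. *)
Lemma simple_annihilated : simple_mod M ->
  forall a (v : M), a \in J -> a *: v = 0.
Proof.
move=> [_ simp] a v aJ; rewrite (scale_frame_sum v) scaler_sumr big1 // => i _.
set w := e i *: v; have ew : e i *: w = w by rewrite scalerA (frame_idem fr).
apply/eqP/negPn/negP => aw0.
have [h|/(_ w)/asboolP[c cw]] := simp (cyclic (a *: w)).
  by case/eqP: aw0; apply: h; apply: cyclic_id.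
have [|b bE] := frame_unit fr (i := i) (a := 1 - c * a).
  apply/negP => h; case/negP: (frame_notin fr i).
  have -> : e i = e i * (1 - c * a) * e i + e i * (c * a) * e i.
    by rewrite -mulrDl -mulrDr subrK mulr1 (frame_idem fr).
  apply: (frameD fr) => //; apply: (frameMr fr); apply: (frameMl fr).
  exact: (frameMl fr).
case/eqP: aw0; rewrite -ew -bE -!scalerA ew scalerBl scale1r -[(c * a) *: w]scalerA.
by rewrite -cw subrr !scaler0.
Qed.

End FrameModule.

Section FrameSocle.
Variable M : lmodType A.

Lemma cyclic_simple i (x : M) : e i *: x != 0 ->
  (forall a, a \in J -> a *: x = 0) -> simple_mod (submod_type (cyclic (e i *: x))).
Proof.
move=> y0 Jx; set y := e i *: x in y0 *.
split; first by exists (Sub y (cyclic_id y)); rewrite -val_eqE.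
move=> N; have [[z zN z0]|h] := pselect (exists2 z, z \in N & z != 0); last first.
  by left=> z zN; apply/eqP/negPn/negP => z0; apply: h; exists z.
right=> u; have /asboolP[a zE] := valP z; have /asboolP[c uE] := valP u.
have ae : a *: y = (e i * a * e i) *: y.
  rewrite {1}(scale_frame_sum (a *: y)) (bigD1 i) //= big1 ?addr0 => [|k ki].
    by rewrite /y !scalerA -!mulrA (frame_idem fr).
  by rewrite /y !scalerA; apply: Jx; apply: (frame_off fr).
have [|b bE] := frame_unit fr (i := i) (a := a).
  apply/negP => h; move: z0; rewrite -val_eqE /= zE ae /y scalerA => /eqP[].
  by apply: Jx; apply: (frameMr fr).
have -> : u = (c * b) *: z; last exact: (@rpredZ _ _ N).
apply: val_inj; rewrite /= uE zE ae scalerA -mulrA bE -scalerA /y.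
by rewrite [e i *: (e i *: x)]scalerA (frame_idem fr).
Qed.

Lemma socleP (x : M) : x \in socle M <-> forall a, a \in J -> a *: x = 0.
Proof.
split=> [/asboolP/(_ (Submod (annihilated_closed M))) h|Jx].
  apply/asboolP/h => y [N simN yN]; apply/asboolP => a aJ.
  exact/(val_scale_eq0 a (Sub y yN : submod_type N)).1/simple_annihilated.
rewrite (scale_frame_sum x); apply: rpred_sum => i _.
have [->|y0] := eqVneq (e i *: x) 0; first exact: rpred0.
apply/asboolP => N; apply; exists (cyclic (e i *: x)); last exact: cyclic_id.
exact: cyclic_simple.
Qed.

End FrameSocle.

(** The socle of A e_i is isomorphic to the top of A e_j when it is generated by
    an element [t] of e_j A e_i; then [a e_j |-> a t] induces the isomorphism. *)
Lemma socle_top_isoP (i j : I) (N N' : submod A^o) :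
  (forall y, y \in N <-> y * e i = y) -> (forall y, y \in N' <-> y * e j = y) ->
  mod_iso (submod_type (socle (submod_type N))) (top_mod J (submod_type N')) <->
  exists t : A, [/\ t * e i = t, e j * t = t, t != 0,
    forall a, a \in J -> a * t = 0 &
    forall u : A, u * e i = u -> (forall a, a \in J -> a * u = 0) ->
      exists a, u = a * t].
Proof.
move=> hN hN'; pose M : lmodType A := submod_type N.
pose M' : lmodType A := submod_type N'; pose Q : lmodType A := top_mod J M'.
rewrite -[submod_type (socle _)]/(submod_type (socle M)) -[top_mod _ _]/Q.
have spanP (x : M') : x \in scale_span J M' <-> val x \in J.
  split=> [/asboolP|xJ].
    have cl : @submod_closed A M' (fun x => val x \in J).
      split=> [|a u v /= hu hv]; first exact: (frame0 fr).
      by apply: (frameD fr) => //; apply: (frameMl fr).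
    move=> /(_ (Submod cl)); apply=> y [a [m [aJ ->]]].
    exact: (@frameMr _ _ _ _ fr (val m) a).
  apply/asboolP => N0; apply; have ej : (e j : A^o) \in N'.
    by apply/hN'; rewrite (frame_idem fr).
  exists (val x), (Sub (e j : A^o) ej : M'); split=> //; apply: val_inj.
  by rewrite GRing.valZ /=; apply/esym/hN'/valP.
have ejN : (e j : A^o) \in N' by apply/hN'; rewrite (frame_idem fr).
pose ej : M' := Sub (e j : A^o) ejN.
pose pi : M' -> Q := quomod_pi (scale_span J M').
have piE (x : M') : pi x = (val x : A) *: pi ej.
  rewrite /pi [RHS]quomod_piZ; congr quomod_pi; apply: val_inj.
  by rewrite GRing.valZ /=; apply/esym/hN'/valP.
have pi_surj u : exists a, u = a *: pi ej.
  rewrite -(quomod_pi_repr u) -/(pi _) piE; set y := val _; by exists y.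
have pi_eq a : a *: pi ej = 0 <-> a * e j \in J.
  have pi0 : pi 0 = 0.
    by apply: (addIr (pi 0)); rewrite add0r /pi -quomod_piD addr0.
  by rewrite -pi0 [a *: pi ej]quomod_piZ quomod_piP subr0 spanP GRing.valZ.
split=> [[f f_bij]|[t [ti jt t0 Jt tgen]]].
  have [g fK gK] := f_bij.
  pose t1 := g (pi ej); pose t : A := val (val t1).
  have ft1 : f t1 = pi ej by rewrite gK.
  have f_inj := can_inj fK.
  have jt1 : e j *: t1 = t1.
    apply: f_inj; rewrite linearZ /= ft1 -[LHS](piE ej) //.
  have Jt a : a \in J -> a * t = 0.
    move=> aJ; have /socleP h := valP t1; exact/(val_scale_eq0 a (val t1)).1/h.
  exists t; split=> //.
  - by apply/hN; apply: valP.
  - by have := congr1 (fun z => val (val z)) jt1; rewrite !GRing.valZ.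
  - apply/eqP => t0; have h : t1 = 0 by do 2!apply: val_inj; rewrite !raddf0.
    have := ft1; rewrite h linear0 => /esym h1.
    have /pi_eq : 1 *: pi ej = 0 by rewrite h1 scaler0.
    by rewrite mul1r; apply/negP/(frame_notin fr).
  move=> u ui Ju; have uN : (u : A^o) \in N by apply/hN.
  have us : (Sub (u : A^o) uN : M) \in socle M.
    by apply/socleP => a aJ; apply/val_scale_eq0; apply: Ju.
  pose u1 : submod_type (socle M) := Sub (Sub (u : A^o) uN : M) us.
  have [a ua] := pi_surj (f u1); exists a.
  have : u1 = a *: t1 by apply: f_inj; rewrite linearZ /= ft1.
  by move=> /(congr1 (fun z => val (val z))); rewrite !GRing.valZ.
have a_t a : a * t = 0 -> a * e j \in J.
  move=> at0; have -> : a * e j = \sum_k e k * a * e j.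
    by rewrite -mulr_suml -mulr_suml (frame_sum fr) mul1r.
  elim/big_ind: _ => [||k _]; [exact: frame0 fr | exact: frameD fr | ].
  have [->|kj] := eqVneq k j; last exact: (frame_off fr).
  apply: contrapT => /negP /(frame_unit fr)[b bE]; case/eqP: t0.
  by rewrite -jt -bE -!mulrA jt at0 !mulr0.
have gen (u : submod_type (socle M)) : exists a, val (val u) = a * t :> A.
  apply: tgen; first by apply/hN; apply: valP.
  by move=> a aJ; have /socleP h := valP u; exact/(val_scale_eq0 a (val u)).1/h.
pose c u := projT1 (cid (gen u)).
have cE u : val (val u) = c u * t :> A by rewrite /c; case: cid.
pose w : {linear submod_type (socle M) -> A^o} :=
  (val : {linear M -> A^o}) \o (val : {linear submod_type (socle M) -> M}).
pose f u := c u *: pi ej.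
have f_uniq u a : w u = a * t :> A -> f u = a *: pi ej.
  move=> uE; apply/eqP; rewrite -subr_eq0 -scalerBl; apply/eqP/pi_eq/a_t.
  by rewrite mulrBl -cE [X in X - _]uE subrr.
have f_lin : linear f.
  move=> a u v; rewrite scalerA -scalerDl; apply: f_uniq.
  by rewrite mulrDl -mulrA -!cE linearP.
pose fL := GRing.isLinear.Build _ _ _ _ f f_lin.
pose F : {linear submod_type (socle M) -> Q} := HB.pack f fL.
have tN : (t : A^o) \in N by apply/hN.
have gN a : ((a * t : A) : A^o) \in N by apply/hN; rewrite -mulrA ti.
have gs a : (Sub ((a * t : A) : A^o) (gN a) : M) \in socle M.
  apply/socleP => b bJ; apply/val_scale_eq0 => /=.
  by rewrite -[LHS]/(b * (a * t)) mulrA; apply: Jt; apply: (frameMr fr).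
exists F.
have fin : injective F.
  move=> u v /eqP; rewrite -subr_eq0 -linearB => /eqP; rewrite /= /f => /pi_eq h.
  apply/eqP; rewrite -subr_eq0; apply/eqP; do 2!apply: val_inj.
  rewrite !raddf0 cE -jt mulrA; exact: Jt.
pose g q : submod_type (socle M) :=
  Sub (Sub ((projT1 (cid (pi_surj q)) * t : A) : A^o) (gN _) : M) (gs _).
have gK : cancel g F.
  move=> q; rewrite /= /g; case: cid => a qE /=; rewrite [RHS]qE.
  exact: f_uniq.
by exists g => // u; apply: fin; apply: gK.
Qed.

End Frame.
(** * Formal matrix rings entry by entry *)

Section Entries.
Variables (I : finType) (S : fmdata I).

Definition munit (i j : I) (a : bimod S i j) : fmx S :=
  mkfmx (fun h k => fm_mul (fm_mul (fm_delta S h i) a) (fm_delta S j k)).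

Lemma munit_id i j (a : bimod S i j) : entry (munit a) i j = a.
Proof. by rewrite mkfmxE !fm_delta_id fm_mul1l fm_mul1r. Qed.

Lemma munit_row i j (a : bimod S i j) h k : h != i -> entry (munit a) h k = 0.
Proof. by move=> hi; rewrite mkfmxE fm_delta_neq // !fm_mul0l. Qed.

Lemma munit_col i j (a : bimod S i j) h k : k != j -> entry (munit a) h k = 0.
Proof.
by move=> kj; rewrite mkfmxE [fm_delta S j k]fm_delta_neq 1?eq_sym // fm_mul0r.
Qed.

Lemma entry0 i j : entry (0 : fmx S) i j = 0.
Proof. exact: mkfmxE. Qed.

Lemma entryD (A B : fmx S) i j : entry (A + B) i j = entry A i j + entry B i j.
Proof. exact: mkfmxE. Qed.

Lemma entryN (A : fmx S) i j : entry (- A) i j = - entry A i j.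
Proof. exact: mkfmxE. Qed.

Lemma entryM (A B : fmx S) i j :
  entry (A * B) i j = \sum_k fm_mul (entry A i k) (entry B k j).
Proof. exact: mkfmxE. Qed.

Lemma entry1 i : entry (1 : fmx S) i i = fm_one S i.
Proof. by rewrite mkfmxE fm_delta_id. Qed.

Lemma entry1_neq i j : i != j -> entry (1 : fmx S) i j = 0.
Proof. by move=> ij; rewrite mkfmxE fm_delta_neq. Qed.

Lemma entry_sum (J : Type) (s : seq J) (P : pred J) (F : J -> fmx S) i j :
  entry (\sum_(h <- s | P h) F h) i j = \sum_(h <- s | P h) entry (F h) i j.
Proof.
by apply: (big_morph (fun A : fmx S => entry A i j)) => [A B|];
  [apply: entryD | apply: entry0].
Qed.

Lemma entry_mul_munit (A : fmx S) i j (a : bimod S i j) h :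
  entry (A * munit a) h j = fm_mul (entry A h i) a.
Proof.
rewrite entryM (bigD1 i) //= munit_id big1 ?addr0 // => k ki.
by rewrite munit_row // fm_mul0r.
Qed.

Lemma entry_mul_munit_col (A : fmx S) i j (a : bimod S i j) h k :
  k != j -> entry (A * munit a) h k = 0.
Proof.
by move=> kj; rewrite entryM big1 // => l _; rewrite munit_col // fm_mul0r.
Qed.

Lemma entry_munit_mul (A : fmx S) i j (a : bimod S i j) k :
  entry (munit a * A) i k = fm_mul a (entry A j k).
Proof.
rewrite entryM (bigD1 j) //= munit_id big1 ?addr0 // => l lj.
by rewrite munit_col // fm_mul0l.
Qed.

Lemma entry_munit_mul_row (A : fmx S) i j (a : bimod S i j) h k :
  h != i -> entry (munit a * A) h k = 0.
Proof.
by move=> hi; rewrite entryM big1 // => l _; rewrite munit_row // fm_mul0l.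
Qed.

Lemma munitM i j k (a : bimod S i j) (b : bimod S j k) :
  munit a * munit b = munit (fm_mul a b).
Proof.
apply: fmxP => h l; have [->|hi] := eqVneq h i; last first.
  by rewrite entry_munit_mul_row // munit_row.
have [->|lk] := eqVneq l k; last by rewrite entry_mul_munit_col // munit_col.
by rewrite entry_munit_mul !munit_id.
Qed.

Lemma munit0 i j : munit (0 : bimod S i j) = 0.
Proof. by apply: fmxP => h k; rewrite mkfmxE fm_mul0r fm_mul0l entry0. Qed.

Lemma canon_idemE i : canon_idem S i = munit (fm_one S i).
Proof.
apply: fmxP => h k; rewrite mkfmxE; have [->|hi] := eqVneq h i.
  by rewrite mkfmxE fm_delta_id !fm_mul1l.
by rewrite munit_row.
Qed.

Lemma entry_idem_mul (A : fmx S) i k :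
  entry (canon_idem S i * A) i k = entry A i k.
Proof. by rewrite canon_idemE entry_munit_mul fm_mul1l. Qed.

Lemma entry_mul_idem (A : fmx S) i h :
  entry (A * canon_idem S i) h i = entry A h i.
Proof. by rewrite canon_idemE entry_mul_munit fm_mul1r. Qed.

Lemma idem_mul_idem (A : fmx S) i j :
  canon_idem S i * A * canon_idem S j = munit (entry A i j).
Proof.
apply: fmxP => h k; have [->|hi] := eqVneq h i; last first.
  by rewrite -mulrA [in LHS]canon_idemE entry_munit_mul_row // munit_row.
have [->|kj] := eqVneq k j; last first.
  by rewrite [X in _ * X]canon_idemE entry_mul_munit_col // munit_col.
by rewrite entry_mul_idem entry_idem_mul munit_id.
Qed.

Lemma mul_idemP (A : fmx S) i :
  A * canon_idem S i = A <-> forall h k, k != i -> entry A h k = 0.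
Proof.
split=> [<- h k ki|h0]; first by rewrite canon_idemE entry_mul_munit_col.
apply: fmxP => h k; have [->|ki] := eqVneq k i; first exact: entry_mul_idem.
by rewrite h0 // canon_idemE entry_mul_munit_col.
Qed.

Lemma idem_mulP (A : fmx S) i :
  canon_idem S i * A = A <-> forall h k, h != i -> entry A h k = 0.
Proof.
split=> [<- h k hi|h0]; first by rewrite canon_idemE entry_munit_mul_row.
apply: fmxP => h k; have [->|hi] := eqVneq h i; first exact: entry_idem_mul.
by rewrite h0 // canon_idemE entry_munit_mul_row.
Qed.

Lemma canon_idem_sum : \sum_i canon_idem S i = 1.
Proof.
apply: fmxP => h k; rewrite entry_sum (bigD1 h) //= big1 ?addr0 => [|i ih].
  by rewrite !mkfmxE eqxx.
by rewrite canon_idemE munit_row // eq_sym.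
Qed.

(** Not right invertible.  Over local corners these are the entries of the
    matrices in the Jacobson radical. *)
Definition radical_elt (h k : I) (a : bimod S h k) : Prop :=
  forall b : bimod S k h, fm_mul a b <> fm_one S h.

Definition left_socle_elt (k i : I) (u : bimod S k i) : Prop :=
  forall h (a : bimod S h k), radical_elt a -> fm_mul a u = 0.

Definition right_socle_elt (i k : I) (u : bimod S i k) : Prop :=
  forall l (b : bimod S k l), radical_elt b -> fm_mul u b = 0.

Definition basic_elt : Prop :=
  forall i j, i != j -> forall (a : bimod S i j) (b : bimod S j i),
    ~ (fm_mul a b = fm_one S i /\ fm_mul b a = fm_one S j).

Definition left_socle_generator (i j : I) (t : bimod S j i) : Prop :=
  [/\ t != 0, left_socle_elt t & forall k (u : bimod S k i), left_socle_elt u ->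
      exists a : bimod S k j, u = fm_mul a t].

Definition right_socle_generator (i j : I) (t : bimod S i j) : Prop :=
  [/\ t != 0, right_socle_elt t & forall k (u : bimod S i k), right_socle_elt u ->
      exists a : bimod S j k, u = fm_mul t a].

Definition nakayama_elt (s : I -> I) : Prop := forall i,
  (exists t, @right_socle_generator i (s i) t) /\
  (exists t, @left_socle_generator (s i) i t).

Definition essential_elt : Prop := forall i j (x : bimod S i j), x != 0 ->
  exists k (a : bimod S j k), fm_mul x a != 0 /\ right_socle_elt (fm_mul x a).

Definition connected_elt : Prop := forall U : {set I},
  (forall i j, i \in U -> j \notin U ->
     (forall a : bimod S i j, a = 0) /\ (forall a : bimod S j i, a = 0)) ->
  U = set0 \/ U = setT.

Lemma radical_mulr h k l (a : bimod S h k) (b : bimod S k l) :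
  radical_elt a -> radical_elt (fm_mul a b).
Proof. by move=> ha c; rewrite -fm_mulA; apply: ha. Qed.

Lemma left_socle_mull h k i (a : bimod S h k) (u : bimod S k i) :
  left_socle_elt u -> left_socle_elt (fm_mul a u).
Proof. by move=> hu l b hb; rewrite fm_mulA hu //; apply: radical_mulr. Qed.

End Entries.

Section LocalCorners.
Variables (I : finType) (S : fmring I).

Lemma fm_one_neq0 i : fm_one S i != 0.
Proof. exact: (local_neq0 (fm_local S i)). Qed.

(** The idempotent [b a] is nonzero, hence the unit of a local ring. *)
Lemma fm_inverse_sym h k (a : bimod S h k) (b : bimod S k h) :
  fm_mul a b = fm_one S h -> fm_mul b a = fm_one S k.
Proof.
move=> ab; have idem : fm_mul (fm_mul b a) (fm_mul b a) = fm_mul b a.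
  by rewrite fm_mulA -(fm_mulA b a b) ab fm_mul1r.
have [ba0|//] := @local_idempotent _ (fm_local S k) (fm_mul b a : corner S k) idem.
have /eqP[] := fm_one_neq0 h; rewrite -[LHS]fm_mul1l -{1}ab -ab.
by rewrite -fm_mulA (fm_mulA b a b) ba0 fm_mul0l fm_mul0r.
Qed.

Lemma radical_mull h k l (a : bimod S h k) (b : bimod S k l) :
  radical_elt b -> radical_elt (fm_mul a b).
Proof.
move=> hb c abc; apply: (hb (fm_mul c a)); rewrite fm_mulA.
by apply: fm_inverse_sym; rewrite fm_mulA.
Qed.

Lemma right_socle_mulr h k i (u : bimod S h k) (a : bimod S k i) :
  right_socle_elt u -> right_socle_elt (fm_mul u a).
Proof. by move=> hu l b hb; rewrite -fm_mulA hu //; apply: radical_mull. Qed.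

Lemma corner_jacobsonP i (a : corner S i) :
  a \in jacobson (corner S i) <-> radical_elt a.
Proof. exact: local_jacobsonP (fm_local S i) a. Qed.

Lemma basic_radical :
  basic_elt S -> forall h k (a : bimod S h k), h != k -> radical_elt a.
Proof.
move=> hb h k a hk b ab; apply: (hb h k hk a b); split=> //.
exact: fm_inverse_sym.
Qed.

(** If [x e_i] were not in the maximal left ideal [m], then [e_i - y x e_i] would
    be in [m] for some [y]; as the entry at (i,i) of this matrix is a unit of the
    local corner, [e_i] itself would be in [m]. *)
Lemma jacobson_fmxP (x : fmx S) :
  x \in jacobson (fmx S) <-> forall i j, radical_elt (entry x i j).
Proof.
split=> [xJ i j b xb|hx].
  have /jacobson_1B[w wE] : canon_idem S i \in jacobson (fmx S).
    rewrite canon_idemE -xb -munitM -idem_mul_idem.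
    by do 2!apply: jacobsonMr; apply: jacobsonMl.
  have : canon_idem S i = 0.
    rewrite -[LHS]mul1r -wE -mulrA mulrBl mul1r canon_idemE munitM fm_mul1l.
    by rewrite subrr mulr0.
  move/(congr1 (fun A : fmx S => entry A i i)).
  by rewrite entry0 canon_idemE munit_id => /eqP; apply/negP/fm_one_neq0.
apply/asboolP => m maxm.
have xe i : ((x * canon_idem S i : fmx S) : (fmx S)^o) \in m.
  apply/negPn/negP => xm.
  pose m' := Submod (add_left_closed m (x * canon_idem S i)).
  have smm' : {subset m <= m'}.
    move=> u um; apply/asboolP; exists u => //; exists 0.
    by rewrite mul0r addr0.
  have [sm|/(_ 1)/asboolP[u um [y uE]]] := maxm.2 m' smm'.
    case/negP: xm; apply: sm; apply/asboolP.
    by exists 0; [apply: rpred0 | exists 1; rewrite mul1r add0r].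
  pose d : corner S i := entry (y * x) i i.
  have dJ : d \in jacobson (corner S i).
    rewrite /d entryM; apply: (@rpred_sum _ (jacobson_submod (corner S i))) => k _.
    by apply/corner_jacobsonP/radical_mull.
  have [c [c1 _]] : exists c : corner S i, c * (1 - d) = 1 /\ (1 - d) * c = 1.
    apply: (local_unit (fm_local S i)); apply/negP => h.
    have: (1 : corner S i) \in jacobson (corner S i).
      by rewrite -[1](subrK d); apply: (@rpredD _ (jacobson_submod (corner S i))).
    exact/negP/local_1_notin_jacobson/fm_local.
  have em : canon_idem S i = munit (c : bimod S i i) * u.
    apply: fmxP => h k; have [->|hi] := eqVneq h i; last first.
      by rewrite canon_idemE munit_row // entry_munit_mul_row.
    rewrite entry_munit_mul -[u : fmx S](addrK (y * (x * canon_idem S i))) -uE.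
    rewrite entryD entryN mulrA; have [->|ki] := eqVneq k i.
      by rewrite entry_mul_idem entry1 canon_idemE munit_id; exact: esym c1.
    rewrite [X in entry (y * x * X)]canon_idemE entry_mul_munit_col // subr0.
    by rewrite entry1_neq 1?eq_sym // fm_mul0r canon_idemE munit_col.
  case/negP: xm; apply: (@rpredZ _ (fmx S)^o m).
  by rewrite em; apply: (@rpredZ _ (fmx S)^o m).
rewrite -[x]mulr1 -(_ : \sum_i canon_idem S i = 1).
  by rewrite mulr_sumr; apply: rpred_sum => i _; apply: xe.
exact: canon_idem_sum.
Qed.

Lemma fmx_frame : basic_elt S ->
  basic_frame (canon_idem S) (jacobson (fmx S)).
Proof.
move=> bas; split.
- exact: (@rpred0 _ (jacobson_submod (fmx S))).
- by move=> x y hx hy; apply: (@rpredD _ (jacobson_submod (fmx S))).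
- by move=> a x; apply: jacobsonMl.
- by move=> a x; apply: jacobsonMr.
- by move=> i; rewrite canon_idemE munitM fm_mul1l.
- exact: canon_idem_sum.
- move=> i; apply/negP => /jacobson_fmxP /(_ i i) /(_ (fm_one S i)).
  by rewrite canon_idemE munit_id fm_mul1l.
- move=> i j a ij; rewrite idem_mul_idem; apply/jacobson_fmxP => h k.
  have [hk|/eqP hk] := eqVneq h k; last by apply: basic_radical => //; apply/eqP.
  rewrite -hk; have [hi|hi] := eqVneq h i; last first.
    by rewrite munit_row // => b; rewrite fm_mul0l => /esym/eqP; apply/negP/fm_one_neq0.
  rewrite munit_col ?hi // => b; rewrite fm_mul0l => /esym/eqP.
  exact/negP/fm_one_neq0.
move=> i a; rewrite idem_mul_idem => nJ.
have [c cE] : exists c : corner S i, c * (entry a i i : corner S i) = 1.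
  apply: (local_left_inverse (fm_local S i)); apply: contra nJ => hJ.
  apply/jacobson_fmxP => h k.
  have [<-|hk] := eqVneq h k; last exact: basic_radical.
  have [->|hi] := eqVneq h i; first by rewrite munit_id; apply/corner_jacobsonP.
  by rewrite munit_row // => b; rewrite fm_mul0l => /esym/eqP; apply/negP/fm_one_neq0.
by exists (munit (c : bimod S i i)); rewrite munitM canon_idemE; congr munit.
Qed.

Lemma fmx_frame_converse : basic_elt S ->
  @basic_frame (fmx S)^c _ (canon_idem S) (jacobson (fmx S)).
Proof.
move=> bas; have fr := fmx_frame bas; split.
- exact: frame0 fr.
- exact: frameD fr.
- exact: frameMr fr.
- exact: frameMl fr.
- exact: frame_idem fr.
- exact: frame_sum fr.
- exact: frame_notin fr.
- move=> i j a ij.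
  change (canon_idem S j * ((a : fmx S) * canon_idem S i) \in jacobson (fmx S)).
  by rewrite mulrA; apply: (frame_off fr); rewrite eq_sym.
move=> i a.
change (canon_idem S i * ((a : fmx S) * canon_idem S i) \notin jacobson (fmx S) ->
  exists b : fmx S, canon_idem S i * ((a : fmx S) * canon_idem S i) * b = canon_idem S i).
rewrite [_ * (_ * _)]mulrA idem_mul_idem => nJ.
have [c [_ cE]] : exists c : corner S i, c * (entry a i i : corner S i) = 1 /\
    (entry a i i : corner S i) * c = 1.
  apply: (local_unit (fm_local S i)); apply: contra nJ => hJ.
  apply/jacobson_fmxP => h k.
  have [<-|hk] := eqVneq h k; last exact: basic_radical.
  have [->|hi] := eqVneq h i; first by rewrite munit_id; apply/corner_jacobsonP.
  by rewrite munit_row // => b; rewrite fm_mul0l => /esym/eqP; apply/negP/fm_one_neq0.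
exists (munit (c : bimod S i i)).
by rewrite munitM canon_idemE; congr munit.
Qed.

End LocalCorners.
(** * Module-theoretic properties of formal matrix rings by entries *)

Section CentralIdempotents.

Definition central_idempotents_trivial (R : pzRingType) : Prop :=
  forall c : R, c * c = c -> (forall x, c * x = x * c) -> c = 0 \/ c = 1.

Section Split.
Variables (R : pzRingType) (c : R).
Hypotheses (cc : c * c = c) (c_central : forall x, c * x = x * c).

Let e := Idempotent cc.

Fact central_peirce (x : R) : c * x \in peirce_pred e.
Proof. by apply/eqP; rewrite /= mulrA cc -mulrA -c_central mulrA cc. Qed.

Fact central_compl_peirce (x : R) : (1 - c) * x \in peirce_pred (idem_compl e).
Proof.
have h : (1 - c) * (1 - c) = 1 - c := idemP (idem_compl e).
have hx : (1 - c) * x = x * (1 - c) by rewrite mulrBl mulrBr mulr1 mul1r c_central.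
by apply/eqP; rewrite /= mulrA h -mulrA -hx mulrA h.
Qed.

Definition peirce_split (x : R) : peirce e * peirce (idem_compl e) :=
  (exist (fun y => y \in peirce_pred e) _ (central_peirce x),
   exist (fun y => y \in peirce_pred (idem_compl e)) _ (central_compl_peirce x)).

Lemma peirce_split_iso :
  ring_iso R (peirce e * peirce (idem_compl e))%type.
Proof.
have fB : zmod_morphism peirce_split.
  by move=> x y; congr (_, _); apply: val_inj; rewrite /= mulrBr.
have cx (d x y : R) : d * d = d -> (forall z, d * z = z * d) ->
    d * (x * y) = d * x * (d * y).
  by move=> dd dC; rewrite -[RHS]mulrA [x * (d * y)]mulrA -dC !mulrA dd.
have c'c : (1 - c) * (1 - c) = 1 - c := idemP (idem_compl e).
have c'C x : (1 - c) * x = x * (1 - c) by rewrite mulrBl mulrBr mulr1 mul1r c_central.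
have fM : monoid_morphism peirce_split.
  split=> [|x y]; congr (_, _); apply: val_inj; rewrite /= ?mulr1 //; exact: cx.
pose fA := GRing.isZmodMorphism.Build _ _ peirce_split fB.
pose fX := GRing.isMonoidMorphism.Build _ _ peirce_split fM.
pose f : {rmorphism R -> (peirce e * peirce (idem_compl e))%type} :=
  HB.pack peirce_split fA fX.
exists f; exists (fun y => val y.1 + val y.2) => [x|[y z]].
  by rewrite /= -mulrDl addrC subrK mul1r.
have /eqP yE := valP y; have /eqP zE := valP z.
have cy : c * val y = val y by rewrite -yE /= !mulrA cc.
have cz : c * val z = 0.
  have c0 : c * (1 - c) = 0 by rewrite mulrBr mulr1 cc subrr.
  by rewrite -zE /= !mulrA c0 !mul0r.
congr (_, _); apply: val_inj; rewrite /= !mulrDr ?cy ?cz ?addr0 //.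
by rewrite !mulrBl !mul1r cy cz subrr subr0 add0r.
Qed.

End Split.

Lemma indecomposable_ringP (R : pzRingType) :
  indecomposable_ring R <-> central_idempotents_trivial R.
Proof.
split=> [ind c cc cC|triv A B [f [g fK gK]]].
  have [->|c0] := eqVneq c 0; first by left.
  have [->|c1] := eqVneq c 1; first by right.
  exfalso; pose e := Idempotent cc.
  have A1 : (1 : peirce e) != 0 by rewrite -val_eqE.
  have B1 : (1 : peirce (idem_compl e)) != 0.
    by rewrite -val_eqE /= subr_eq0 eq_sym.
  pose mA := GRing.PzSemiRing_isNonZero.Build (peirce e) A1.
  pose mB := GRing.PzSemiRing_isNonZero.Build (peirce (idem_compl e)) B1.
  pose A : nzRingType := HB.pack (peirce e) mA.
  pose B : nzRingType := HB.pack (peirce (idem_compl e)) mB.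
  by apply: (ind A B); apply: (peirce_split_iso cc cC).
have f_inj := can_inj fK.
have [|x|/(congr1 f)|/(congr1 f)] := triv (g (1, 0)).
- by apply: f_inj; rewrite rmorphM !gK; congr (_, _); rewrite ?mulr1 ?mulr0.
- apply: f_inj; rewrite !rmorphM !gK; case: (f x) => y z.
  by congr (_, _); rewrite /= ?mulr1 ?mul1r ?mul0r ?mulr0.
- by rewrite gK rmorph0 => -[/eqP]; rewrite oner_eq0.
- by rewrite gK rmorph1 => -[/esym/eqP]; rewrite oner_eq0.
Qed.

End CentralIdempotents.
Section EntryCharacterizations.
Variables (I : finType) (S : fmring I).

Lemma radical0 h k : radical_elt (0 : bimod S h k).
Proof. by move=> b; rewrite fm_mul0l => /esym/eqP; apply/negP/fm_one_neq0. Qed.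

Lemma munit_jacobson h k (a : bimod S h k) :
  radical_elt a -> munit a \in jacobson (fmx S).
Proof.
move=> ha; apply/jacobson_fmxP => i j.
have [->|ih] := eqVneq i h; last by rewrite munit_row //; apply: radical0.
have [->|jk] := eqVneq j k; last by rewrite munit_col //; apply: radical0.
by rewrite munit_id.
Qed.

Lemma munit_inj i j : injective (@munit _ S i j).
Proof.
by move=> a b /(congr1 (fun A : fmx S => entry A i j)); rewrite !munit_id.
Qed.

Lemma munit_eq0 i j (a : bimod S i j) : (munit a == 0) = (a == 0).
Proof. by rewrite -(munit0 S i j) (inj_eq (@munit_inj i j)). Qed.

Lemma munit_entry (A : fmx S) i j :
  canon_idem S i * A = A -> A * canon_idem S j = A -> A = munit (entry A i j).
Proof. by move=> iA Aj; rewrite -idem_mul_idem iA Aj. Qed.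

Lemma entry_mul_row (A B : fmx S) i j k : A * canon_idem S j = A ->
  entry (A * B) i k = fm_mul (entry A i j) (entry B j k).
Proof.
move=> /mul_idemP h; rewrite entryM (bigD1 j) //= big1 ?addr0 // => l lj.
by rewrite h // fm_mul0l.
Qed.

Lemma entry_mul_col (A B : fmx S) i j k : canon_idem S j * B = B ->
  entry (A * B) i k = fm_mul (entry A i j) (entry B j k).
Proof.
move=> /idem_mulP h; rewrite entryM (bigD1 j) //= big1 ?addr0 // => l lj.
by rewrite h // fm_mul0r.
Qed.

Lemma right_principalP (A : fmx S) i :
  A \in Submod (right_principal_closed (canon_idem S i)) <-> canon_idem S i * A = A.
Proof.
have ii : canon_idem S i * canon_idem S i = canon_idem S i.
  by rewrite canon_idemE munitM fm_mul1l.
split=> [/asboolP[B ->]|h]; first by rewrite mulrA ii.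
by apply/asboolP; exists A.
Qed.

Lemma left_principalP (A : fmx S) i :
  A \in Submod (left_principal_closed (canon_idem S i)) <-> A * canon_idem S i = A.
Proof.
have ii : canon_idem S i * canon_idem S i = canon_idem S i.
  by rewrite canon_idemE munitM fm_mul1l.
split=> [/asboolP[B ->]|h]; first by rewrite -mulrA ii.
by apply/asboolP; exists A.
Qed.

(** An isomorphism e_i R -> e_j R is the left multiplication by the image of e_i. *)
Lemma basicP : basic S <-> basic_elt S.
Proof.
split=> [bas i j ij a b [ab ba]|bas i j ij [f [g fK gK]]].
  apply: (bas i j ij).
  pose M := right_principal (canon_idem S i); pose N := right_principal (canon_idem S j).
  have fP (x : M) : (munit b * (val x : fmx S) : ((fmx S)^c)^o) \in
      Submod (right_principal_closed (canon_idem S j)).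
    by apply/right_principalP; rewrite mulrA canon_idemE munitM fm_mul1l.
  have gP (x : N) : (munit a * (val x : fmx S) : ((fmx S)^c)^o) \in
      Submod (right_principal_closed (canon_idem S i)).
    by apply/right_principalP; rewrite mulrA canon_idemE munitM fm_mul1l.
  pose f (x : M) : N :=
    (Sub (munit b * (val x : fmx S) : ((fmx S)^c)^o) (fP x) : submod_type _).
  pose g (x : N) : M :=
    (Sub (munit a * (val x : fmx S) : ((fmx S)^c)^o) (gP x) : submod_type _).
  have f_lin : linear f.
    pose wM : {linear M -> ((fmx S)^c)^o} := val.
    pose wN : {linear N -> ((fmx S)^c)^o} := val.
    move=> c x y; apply: val_inj; rewrite -[LHS]/(munit b * wM (c *: x + y)).
    rewrite -[RHS]/(wN (c *: f x + f y)) !linearP mulrDr; congr (_ + _).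
    exact: (@mulrA (fmx S) (munit b) (val x) c).
  pose fL := GRing.isLinear.Build _ _ _ _ f f_lin.
  pose F : {linear M -> N} := HB.pack f fL.
  exists F; exists g => x; apply: val_inj; rewrite /= mulrA munitM.
    by rewrite ab -canon_idemE; apply/right_principalP; exact: (valP x).
  by rewrite ba -canon_idemE; apply/right_principalP; exact: (valP x).
have ii h : canon_idem S h * canon_idem S h = canon_idem S h.
  by rewrite canon_idemE munitM fm_mul1l.
have eP h : (canon_idem S h : ((fmx S)^c)^o) \in
    Submod (right_principal_closed (canon_idem S h)).
  by apply/right_principalP.
pose ei : right_principal (canon_idem S i) :=
  (Sub (canon_idem S i : ((fmx S)^c)^o) (eP i) : submod_type _).
pose ej : right_principal (canon_idem S j) :=
  (Sub (canon_idem S j : ((fmx S)^c)^o) (eP j) : submod_type _).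
pose y : fmx S := val (f ei).
have g_lin : linear g by move=> c u v; apply: (can_inj fK); rewrite gK linearP !gK.
pose gL := GRing.isLinear.Build _ _ _ _ g g_lin.
pose G : {linear right_principal (canon_idem S j) -> right_principal (canon_idem S i)} :=
  HB.pack g gL.
have scale_id h (x : right_principal (canon_idem S h)) (c : fmx S) :
  val ((c : (fmx S)^c) *: x) = (val x : fmx S) * c :> fmx S by rewrite GRing.valZ.
have jy : canon_idem S j * y = y by apply/right_principalP/valP.
have yi : y * canon_idem S i = y.
  rewrite -[LHS]scale_id -linearZ /=; congr (val (f _)); apply: val_inj.
  by rewrite scale_id /= ii.
pose z : fmx S := val (g ej).
have iz : canon_idem S i * z = z by apply/right_principalP/valP.
have zj : z * canon_idem S j = z.
  rewrite -[LHS]scale_id -[g ej]/(G ej) -linearZ /=.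
  congr (val (g _)); apply: val_inj.
  by rewrite scale_id /= ii.
have zy : z * y = canon_idem S i.
  rewrite -[LHS]scale_id -[g ej]/(G ej) -linearZ /= -[RHS]/(val ei) -[ei in RHS]fK.
  by congr (val (g _)); apply: val_inj; rewrite scale_id.
have ab : fm_mul (entry z i j) (entry y j i) = fm_one S i.
  by rewrite -entry_mul_row // zy canon_idemE munit_id.
by apply: (bas i j ij (entry z i j) (entry y j i)); split=> //; apply: fm_inverse_sym.
Qed.

Lemma right_socleP_munit i k (u : bimod S i k) :
  right_socle_elt u <-> forall a, a \in jacobson (fmx S) -> munit u * a = 0.
Proof.
split=> [hu a /jacobson_fmxP aJ|hu l b hb]; last first.
  by apply: (@munit_inj i l); rewrite -munitM hu ?munit0 //; apply: munit_jacobson.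
apply: fmxP => h l; rewrite entry0; have [->|hi] := eqVneq h i.
  by rewrite entry_munit_mul hu.
by rewrite entry_munit_mul_row.
Qed.

Lemma left_socleP_munit k i (u : bimod S k i) :
  left_socle_elt u <-> forall a, a \in jacobson (fmx S) -> a * munit u = 0.
Proof.
split=> [hu a /jacobson_fmxP aJ|hu l b hb]; last first.
  by apply: (@munit_inj l i); rewrite -munitM hu ?munit0 //; apply: munit_jacobson.
apply: fmxP => h l; rewrite entry0; have [->|li] := eqVneq l i.
  by rewrite entry_mul_munit hu.
by rewrite entry_mul_munit_col.
Qed.

Lemma right_socle_entry (A : fmx S) i k :
  (forall a, a \in jacobson (fmx S) -> A * a = 0) -> right_socle_elt (entry A i k).
Proof.
move=> hA l b hb; rewrite -entry_mul_munit hA ?entry0 //; exact: munit_jacobson.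
Qed.

Lemma left_socle_entry (A : fmx S) k i :
  (forall a, a \in jacobson (fmx S) -> a * A = 0) -> left_socle_elt (entry A k i).
Proof.
move=> hA l b hb; rewrite -entry_munit_mul hA ?entry0 //; exact: munit_jacobson.
Qed.

Lemma right_socle_top_isoP i j : basic_elt S ->
  mod_iso (submod_type (socle (right_principal (canon_idem S i))))
          (top_mod (jacobson (fmx S) : {pred (fmx S)^c})
                   (right_principal (canon_idem S j))) <->
  exists t : bimod S i j, right_socle_generator t.
Proof.
move=> bas; have fr := fmx_frame_converse bas.
pose N k := Submod (right_principal_closed (canon_idem S k)).
rewrite -[right_principal (canon_idem S i)]/(submod_type (N i) : lmodType _).
rewrite -[right_principal (canon_idem S j)]/(submod_type (N j) : lmodType _).
have := @socle_top_isoP _ _ _ _ fr i j (N i) (N j) _ _.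
move=> /(_ (fun y => right_principalP y i) (fun y => right_principalP y j)) ->.
split=> [[t0 [it tj t00 Jt tgen]]|[t [t0 ht tgen]]].
  pose t : fmx S := t0; have tE := munit_entry it tj.
  exists (entry t i j); split.
  - by rewrite -munit_eq0 -tE.
  - exact: right_socle_entry.
  move=> k u /right_socleP_munit hu.
  have [||a uE] := tgen (munit u) => //.
    by change (canon_idem S i * munit u = munit u); rewrite canon_idemE munitM fm_mul1l.
  exists (entry (a : fmx S) j k).
  by rewrite -[LHS]munit_id uE; apply: entry_mul_row.
exists (munit t); split.
- by change (canon_idem S i * munit t = munit t); rewrite canon_idemE munitM fm_mul1l.
- by change (munit t * canon_idem S j = munit t); rewrite canon_idemE munitM fm_mul1r.
- by rewrite munit_eq0.
- by move=> a; move: a; apply/right_socleP_munit.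
move=> u iu Ju.
have gen k : exists a, entry (u : fmx S) i k = fm_mul t a.
  by apply: tgen; apply: right_socle_entry.
pose a := \sum_k munit (projT1 (cid (gen k))).
exists a; change ((u : fmx S) = munit t * a); apply: fmxP => h k.
have [->|hi] := eqVneq h i; last first.
  by rewrite entry_munit_mul_row //; move/idem_mulP: iu => ->.
rewrite entry_munit_mul entry_sum (bigD1 k) //= munit_id big1 ?addr0.
  by case: cid.
by move=> l lk; rewrite munit_col // eq_sym.
Qed.

Lemma left_socle_top_isoP i j : basic_elt S ->
  mod_iso (submod_type (socle (left_principal (canon_idem S i))))
          (top_mod (jacobson (fmx S)) (left_principal (canon_idem S j))) <->
  exists t : bimod S j i, left_socle_generator t.
Proof.
move=> bas; have fr := fmx_frame bas.
pose N k := Submod (left_principal_closed (canon_idem S k)).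
rewrite -[left_principal (canon_idem S i)]/(submod_type (N i) : lmodType _).
rewrite -[left_principal (canon_idem S j)]/(submod_type (N j) : lmodType _).
have := @socle_top_isoP _ _ _ _ fr i j (N i) (N j) _ _.
move=> /(_ (fun y => left_principalP y i) (fun y => left_principalP y j)) ->.
split=> [[t [ti jt t0 Jt tgen]]|[t [t0 ht tgen]]].
  have tE := munit_entry jt ti.
  exists (entry t j i); split.
  - by rewrite -munit_eq0 -tE.
  - exact: left_socle_entry.
  move=> k u /left_socleP_munit hu.
  have [||a uE] := tgen (munit u) => //.
    by rewrite canon_idemE munitM fm_mul1r.
  exists (entry a k j).
  by rewrite -[LHS]munit_id uE; apply: entry_mul_col.
exists (munit t); split.
- by rewrite canon_idemE munitM fm_mul1r.
- by rewrite canon_idemE munitM fm_mul1l.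
- by rewrite munit_eq0.
- by move=> a; move: a; apply/left_socleP_munit.
move=> u ui Ju.
have gen k : exists a, entry u k i = fm_mul a t.
  by apply: tgen; apply: left_socle_entry.
pose a := \sum_k munit (projT1 (cid (gen k))).
exists a; apply: fmxP => k h.
have [->|hi] := eqVneq h i; last first.
  by rewrite entry_mul_munit_col //; move/mul_idemP: ui => ->.
rewrite entry_mul_munit entry_sum (bigD1 k) //= munit_id big1 ?addr0.
  by case: cid.
by move=> l lk; rewrite munit_row // eq_sym.
Qed.

Lemma nakayama_permutationP (s : {perm I}) : basic_elt S ->
  nakayama_permutation S s <-> nakayama_elt S s.
Proof.
move=> bas; split=> h i; have [h1 h2] := h i; split.
- exact/right_socle_top_isoP.
- exact/left_socle_top_isoP.
- exact/right_socle_top_isoP.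
- exact/left_socle_top_isoP.
Qed.

End EntryCharacterizations.
Section RingProperties.
Variables (I : finType) (S : fmring I).

(** A matrix meeting the socle is built row by row: multiplying on the right
    keeps the socle rows in the socle and can move one more row into it without
    killing that row. *)
Lemma essential_right_socleP : basic_elt S ->
  essential_right_socle (fmx S) <-> essential_elt S.
Proof.
move=> bas; have fr := fmx_frame_converse bas.
have socP (x : fmx S) : (x : ((fmx S)^c)^o) \in socle ((fmx S)^c)^o <->
    forall a, a \in jacobson (fmx S) -> x * a = 0.
  exact: (socleP fr (x : ((fmx S)^c)^o)).
split=> [ess i j x x0|ess N [X XN X0]].
  pose N := @cyclic (fmx S)^c ((fmx S)^c)^o (munit x).
  have [|y [ys /asboolP[a yE] y0]] := ess N.
    by exists (munit x); [apply: cyclic_id | rewrite munit_eq0].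
  have {}yE : y = munit x * a by [].
  have [k yk] : exists k, entry (y : fmx S) i k != 0.
    apply: contrapT => h; case/eqP: y0; apply: fmxP => h' k; rewrite entry0.
    have [->|hi] := eqVneq h' i; last by rewrite yE entry_munit_mul_row.
    by apply/eqP/negPn/negP => yk; apply: h; exists k.
  exists k, (entry (a : fmx S) j k); rewrite -entry_munit_mul -yE; split=> //.
  exact/right_socle_entry/socP.
have [j Xj0] : exists j, (X : fmx S) * canon_idem S j != 0.
  apply: contrapT => h; case/eqP: X0; apply: fmxP => h' k; rewrite entry0.
  rewrite -entry_mul_idem.
  suff -> : (X : fmx S) * canon_idem S k = 0 by rewrite entry0.
  by apply/eqP/negPn/negP => Xk; apply: h; exists k.
have NM (Y a : fmx S) : (Y : ((fmx S)^c)^o) \in N -> (Y * a : ((fmx S)^c)^o) \in N.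
  exact: (@rpredZ _ ((fmx S)^c)^o N a Y).
have {X XN X0 Xj0} : exists Y : fmx S,
    [/\ (Y : ((fmx S)^c)^o) \in N, Y * canon_idem S j = Y & Y != 0].
  exists ((X : fmx S) * canon_idem S j); split=> //; first exact: NM.
  by rewrite -mulrA; congr (_ * _); apply: (frame_idem (fmx_frame bas)).
move=> [Y [YN Yj Y0]].
pose bad (j : I) (Y : fmx S) := [set i | `[< ~ right_socle_elt (entry Y i j) >]].
have [m le_m] := ubnP #|bad j Y|; elim: m => // m IHm in j Y YN Yj Y0 le_m *.
have [bad0|/set0Pn[i]] := eqVneq (bad j Y) set0.
  exists Y; split=> //; apply/socP => a /jacobson_fmxP aJ.
  apply: fmxP => i k; rewrite (entry_mul_row a i k Yj) entry0.
  have : i \notin bad j Y by rewrite bad0 inE.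
  by rewrite inE => /asboolPn/contrapT hs; apply: hs; apply: aJ.
rewrite inE => /asboolP nsi.
have [k [a [xa0 xas]]] : exists k (a : bimod S j k),
    fm_mul (entry Y i j) a != 0 /\ right_socle_elt (fm_mul (entry Y i j) a).
  apply: ess; apply/eqP => h; apply: nsi => l b _.
  by rewrite h fm_mul0l.
apply: (IHm k (Y * munit a)).
- exact: NM.
- by rewrite -mulrA canon_idemE munitM fm_mul1r.
- apply: contraNneq xa0 => h; by rewrite -entry_mul_munit h entry0.
rewrite ltnS in le_m; apply: leq_trans le_m; apply: proper_card; apply/properP; split.
  apply/subsetP => h; rewrite !inE => /asboolP hs; apply/asboolP => hs'; apply: hs.
  by rewrite entry_mul_munit; apply: right_socle_mulr.
exists i; first by rewrite inE; apply/asboolP.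
by rewrite inE; apply/asboolP; rewrite entry_mul_munit => /(_ xas).
Qed.

(** A central idempotent is diagonal, with entries 0 or 1. *)
Lemma indecomposable_fmxP : indecomposable_ring (fmx S) <-> connected_elt S.
Proof.
rewrite indecomposable_ringP; split=> [triv U hU|conn c cc cC].
  pose c := \sum_(h in U) canon_idem S h.
  have cC x : c * x = x * c.
    apply: fmxP => i j.
    have -> : entry (c * x) i j = if i \in U then entry x i j else 0.
      exact: canon_sum_mulE.
    have -> : entry (x * c) i j = if j \in U then entry x i j else 0.
      exact: mul_canon_sumE.
    case: ifPn => iU; case: ifPn => jU //.
      exact: (hU i j iU jU).1.
    exact: esym ((hU j i jU iU).2 _).
  have cii i : entry c i i = if i \in U then fm_one S i else 0.
    by rewrite -[in RHS](fm_delta_id S i); apply: canon_sumE.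
  have [h|h] := triv c (canon_sum_idem S U) cC; [left | right].
    apply/setP => i; rewrite inE; apply/negP => iU; move: (cii i).
    by rewrite iU h entry0 => /esym/eqP; apply/negP/fm_one_neq0.
  apply/setP => i; rewrite inE; apply/negPn/negP => iU; move: (cii i).
  by rewrite (negbTE iU) h entry1 => /eqP; apply/negP/fm_one_neq0.
have c_off i j : i != j -> entry c i j = 0.
  move=> ij; have := congr1 (fun A : fmx S => entry A i j) (cC (canon_idem S i)).
  rewrite entry_idem_mul => <-.
  by rewrite canon_idemE entry_mul_munit_col // eq_sym.
have c_mul_l i j (a : bimod S i j) : fm_mul (entry c i i) a = fm_mul a (entry c j j).
  have := congr1 (fun A : fmx S => entry A i j) (cC (munit a)).
  by rewrite entry_mul_munit entry_munit_mul.
have c_diag i : entry c i i = 0 \/ entry c i i = fm_one S i.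
  apply: (@local_idempotent _ (fm_local S i) (entry c i i : corner S i)).
  rewrite -[in RHS]cc entryM (bigD1 i) //= big1 ?addr0 // => k ki.
  by rewrite c_off 1?eq_sym // fm_mul0l.
pose U := [set i | `[< entry c i i = fm_one S i >]].
have UP i : i \in U -> entry c i i = fm_one S i by rewrite inE => /asboolP.
have UN i : i \notin U -> entry c i i = 0.
  by rewrite inE => /asboolPn; case: (c_diag i).
have [i j iU jU||] := conn U.
- split=> a.
    by rewrite -[a]fm_mul1l -(UP i iU) c_mul_l (UN j jU) fm_mul0r.
  by rewrite -[a]fm_mul1r -(UP i iU) -c_mul_l (UN j jU) fm_mul0l.
- move=> U0; left; apply: fmxP => i j; rewrite entry0.
  have [<-|/c_off //] := eqVneq i j; apply: UN; by rewrite U0 inE.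
move=> UT; right; apply: fmxP => i j.
have [<-|ij] := eqVneq i j; last by rewrite c_off // entry1_neq.
by rewrite entry1; apply: UP; rewrite UT inE.
Qed.

End RingProperties.

(** * Reindexing and corners *)

Lemma ring_iso_trans (A B C : pzRingType) :
  ring_iso A B -> ring_iso B C -> ring_iso A C.
Proof.
move=> [f f_bij] [g g_bij].
pose h : {rmorphism A -> C} := g \o f.
by exists h; apply: bij_comp.
Qed.

(** For an injective [g] this is e S e, where e is the sum of the canonical
    idempotents at the image of [g]; for a bijective [g] it is a mere renaming of
    the indices. *)
Section Pullback.
Variables (I J : finType) (S : fmring I) (g : J -> I).

Definition fm_pullback_data : fmdata J :=
  {| bimod := fun i j => bimod S (g i) (g j);
     fm_one := fun i => fm_one S (g i);
     fm_mul := fun i j k => @fm_mul _ S (g i) (g j) (g k);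
     fm_mulDl := fun i j k => @fm_mulDl _ S (g i) (g j) (g k);
     fm_mulDr := fun i j k => @fm_mulDr _ S (g i) (g j) (g k);
     fm_mulA := fun i j k l => @fm_mulA _ S (g i) (g j) (g k) (g l);
     fm_mul1l := fun i j => @fm_mul1l _ S (g i) (g j);
     fm_mul1r := fun i j => @fm_mul1r _ S (g i) (g j) |}.

Definition fm_pullback : fmring J :=
  @FMRing _ fm_pullback_data (fun i => fm_local S (g i)).

Hypothesis (g_inj : injective g).

Variable c : idem_elt (fmx S).
Hypothesis c_val : idem_val c = \sum_(h in [set g j | j : J]) canon_idem S h.

Lemma peirce_pullback : ring_iso (peirce c) (fmx fm_pullback).
Proof.
pose E := [set g j | j : J].
have cE : idem_val c = \sum_(h in E) canon_idem S h := c_val.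
have entry_out (x : peirce c) h k : (h \notin E) || (k \notin E) ->
    entry (val x : fmx S) h k = 0.
  rewrite -(eqP (valP x)) cE mul_canon_sumE canon_sum_mulE.
  by case: (h \in E); case: (k \in E).
pose f (x : peirce c) : fmx fm_pullback :=
  @mkfmx _ fm_pullback (fun i j => entry (val x : fmx S) (g i) (g j)).
have gE j : g j \in E by apply: imset_f.
have fB : zmod_morphism f by move=> x y; apply: fmxP => i j; rewrite !mkfmxE.
have fM : monoid_morphism f.
  split=> [|x y]; apply: fmxP => i j; rewrite !mkfmxE.
    rewrite /= cE canon_sumE gE; have [->|ij] := eqVneq i j.
      by rewrite !fm_delta_id.
    by rewrite !fm_delta_neq // (inj_eq g_inj).
  rewrite (bigID (mem E)) /= addrC big1 ?add0r => [|k kE]; last first.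
    by rewrite entry_out ?kE ?orbT // fm_mul0l.
  rewrite (reindex_onto g (fun i => odflt j [pick l | g l == i])) /=.
    apply: eq_big => [k|k _]; last by rewrite !mkfmxE.
    rewrite gE; case: pickP => [l /eqP/g_inj->|/(_ k)]; last by rewrite eqxx.
    by rewrite eqxx.
  move=> k /imsetP[l _ ->]; case: pickP => [l' /eqP //|/(_ l)].
  by rewrite eqxx.
pose fA := GRing.isZmodMorphism.Build _ _ f fB.
pose fX := GRing.isMonoidMorphism.Build _ _ f fM.
pose F : {rmorphism peirce c -> fmx fm_pullback} := HB.pack f fA fX.
pose ext (A : fmx fm_pullback) : fmx S :=
  \sum_i \sum_j @munit _ S (g i) (g j) (entry A i j).
have extE A i j : entry (ext A) (g i) (g j) = entry A i j.
  rewrite /ext entry_sum (bigD1 i) //= [X in _ + X]big1 ?addr0 => [|k ki].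
    rewrite entry_sum (bigD1 j) //= big1 ?addr0 ?munit_id // => k kj.
    by rewrite munit_col // (inj_eq g_inj) eq_sym.
  rewrite entry_sum big1 // => l _.
  by rewrite munit_row // (inj_eq g_inj) eq_sym.
have extP A : ext A \in peirce_pred c.
  apply/eqP; rewrite cE; apply: fmxP => h k; rewrite mul_canon_sumE canon_sum_mulE.
  have ext0 : (h \notin E) || (k \notin E) -> entry (ext A) h k = 0.
    move=> hk; rewrite entry_sum big1 // => i _; rewrite entry_sum big1 // => j _.
    have [hi|] := eqVneq h (g i); last exact: munit_row.
    have [kj|] := eqVneq k (g j); last exact: munit_col.
    by rewrite hi kj !gE in hk.
  by case: (boolP (h \in E)) ext0; case: (boolP (k \in E)) => //= _ _ ->.
exists F; exists (fun A => exist _ (ext A) (extP A)) => [x|A]; last first.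
  by apply: fmxP => i j; rewrite mkfmxE extE.
apply: val_inj; apply: fmxP => h k /=.
have /eqP := extP (f x); rewrite cE.
have [/imsetP[i _ ->]|hE] := boolP (h \in E); last first.
  by move=> <-; rewrite mul_canon_sumE canon_sum_mulE (negbTE hE) if_same entry_out ?hE.
have [/imsetP[j _ ->]|kE] := boolP (k \in E); last first.
  by move=> <-; rewrite mul_canon_sumE (negbTE kE) entry_out ?kE ?orbT.
by rewrite extE mkfmxE.
Qed.

End Pullback.
(** * Gluing two formal matrix rings along bimodules *)

(** The coordinate bimodule at a position where it is [V] or zero, according to
    [b].  As a subgroup of [V], it has the same operations in both cases. *)
Section Gated.
Variables (V : zmodType) (b : bool).

Definition gate_pred : {pred V} := fun v => b || (v == 0).

Fact gate_closed : zmod_closed gate_pred.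
Proof.
split=> [|x y]; rewrite /in_mem /= /gate_pred; first by rewrite eqxx orbT.
by case: b => //= /eqP-> /eqP->; rewrite subr0.
Qed.

Definition gated : Type := {v : V | v \in gate_pred}.
HB.instance Definition _ := SubChoice.on gated.
HB.instance Definition _ := GRing.isZmodClosed.Build V gate_pred gate_closed.
HB.instance Definition _ := GRing.SubChoice_isSubZmodule.Build V _ gated gate_closed.

Fact gate_subproof (v : V) : (if b then v else 0) \in gate_pred.
Proof. by rewrite /in_mem /= /gate_pred; case: b; rewrite //= eqxx. Qed.

Definition gate (v : V) :
  gated := exist (fun v => v \in gate_pred) _ (gate_subproof v).

Lemma gateE v : (~~ b -> v = 0) -> val (gate v) = v.
Proof. by rewrite /=; case: b => // ->. Qed.

Lemma gated0 (x : gated) : ~~ b -> val x = 0.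
Proof.
move=> nb; have : b || (val x == 0) := valP x.
by rewrite (negbTE nb) => /eqP.
Qed.

End Gated.

(** What gluing uses of a formal matrix ring.  The map [res_map] is the projection
    of the corners at [E] to their residue skew field, extended by zero to all the
    entries; [soc_map] embeds [K] as the socle at the positions (i, s i) with i in
    [E] and is zero at the others.  With these extensions the laws hold at all
    positions, and products can be defined without a case distinction on the
    positions. *)
Record link (I : finType) (S : fmring I) (K : pzRingType) (E : {set I}) (s : I -> I) :=
  Link {
  res_map : forall h i, bimod S h i -> K;
  soc_map : forall i k, K -> bimod S i k;
  res_mapD : forall h i (a b : bimod S h i), res_map (a + b) = res_map a + res_map b;
  res_mapM : forall h i j (a : bimod S h i) (b : bimod S i j),
    res_map (fm_mul a b) = res_map a * res_map b;
  res_map1 : forall i, i \in E -> res_map (fm_one S i) = 1;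
  res_map_outl : forall h i (a : bimod S h i), h \notin E -> res_map a = 0;
  res_map_outr : forall h i (a : bimod S h i), i \notin E -> res_map a = 0;
  res_map_radical : forall h i (a : bimod S h i), radical_elt a -> res_map a = 0;
  soc_mapD : forall i k c d, soc_map i k (c + d) = soc_map i k c + soc_map i k d;
  soc_map_l : forall h i k (a : bimod S h i) c,
    fm_mul a (soc_map i k c) = soc_map h k (res_map a * c);
  soc_map_r : forall i k l c (a : bimod S k l),
    fm_mul (soc_map i k c) a = soc_map i l (c * res_map a);
  res_soc_map : forall i k c, res_map (soc_map i k c) = 0;
  soc_map_neq0 : forall i c, i \in E -> c != 0 -> soc_map i (s i) c != 0;
  soc_map_right_socle : forall i k (u : bimod S i k), i \in E -> right_socle_elt u ->
    exists c, u = soc_map i k c;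
  soc_map_left_socle : forall i k (u : bimod S k (s i)), i \in E -> left_socle_elt u ->
    exists c, u = soc_map k (s i) c;
  link_stable : forall i, (s i \in E) = (i \in E)
}.

Section LinkTheory.
Variables (I : finType) (S : fmring I) (K : pzRingType) (E : {set I}) (s : I -> I).
Variable lk : link S K E s.

Lemma soc_map0 i k : soc_map lk i k 0 = 0.
Proof. by apply: (addIr (soc_map lk i k 0)); rewrite -soc_mapD !add0r. Qed.

Lemma res_map_right_socle i k (u : bimod S i k) :
  right_socle_elt u -> res_map lk u = 0.
Proof.
have [iE /(soc_map_right_socle lk iE)[c ->]|iE _] := boolP (i \in E).
  exact: res_soc_map.
exact: res_map_outl.
Qed.

Lemma res_map_left_socle i k (u : bimod S k (s i)) :
  left_socle_elt u -> res_map lk u = 0.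
Proof.
have [iE /(soc_map_left_socle lk iE)[c ->]|iE _] := boolP (i \in E).
  exact: res_soc_map.
by apply: res_map_outr; rewrite (link_stable lk).
Qed.

Lemma right_socle_soc_map i k c : right_socle_elt (soc_map lk i k c).
Proof. by move=> l b hb; rewrite soc_map_r res_map_radical // mulr0 soc_map0. Qed.

End LinkTheory.

Section BimoduleZero.
Variables (K L : pzRingType) (X : bimodule K L).

Lemma bm_l0l (x : X) : bm_l 0 x = 0.
Proof. by apply: (addIr (bm_l 0 x)); rewrite -bm_lDl !add0r. Qed.

Lemma bm_l0r a : bm_l a (0 : X) = 0.
Proof. by apply: (addIr (bm_l a 0)); rewrite -bm_lDr !add0r. Qed.

Lemma bm_r0l a : bm_r (0 : X) a = 0.
Proof. by apply: (addIr (bm_r 0 a)); rewrite -bm_rDl !add0r. Qed.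

Lemma bm_r0r (x : X) : bm_r x 0 = 0.
Proof. by apply: (addIr (bm_r x 0)); rewrite -bm_rDr !add0r. Qed.

Variables (Y : bimodule L K) (p : pairing X Y).

Lemma pair0l y : p 0 y = 0.
Proof. by apply: (addIr (p 0 y)); rewrite -pairDl !add0r. Qed.

End BimoduleZero.

Section LinkedBimodule.
Variables (I I' : finType) (S : fmring I) (S' : fmring I') (K L : pzRingType).
Variables (E : {set I}) (E' : {set I'}) (s : I -> I) (s' : I' -> I').
Variables (V : bimodule K L).

Definition linked (i : I) (j : I') :
  zmodType := gated V ((i \in E) && (j \in E')).

Lemma linked_valD i j (x y : linked i j) : val (x + y) = val x + val y.
Proof. exact: raddfD. Qed.

Variables (lk : link S K E s) (lk' : link S' L E' s').

Definition linked_l h i j (a : bimod S h i) (x : linked i j) : linked h j :=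
  gate _ (bm_l (res_map lk a) (val x)).

Definition linked_r i j k (x : linked i j) (b : bimod S' j k) : linked i k :=
  gate _ (bm_r (val x) (res_map lk' b)).

Lemma linked_lE h i j (a : bimod S h i) (x : linked i j) :
  val (linked_l a x) = bm_l (res_map lk a) (val x).
Proof.
rewrite gateE // negb_and => /orP[hE|jE].
  by rewrite res_map_outl // bm_l0l.
by rewrite gated0 ?bm_l0r // negb_and jE orbT.
Qed.

Lemma linked_rE i j k (x : linked i j) (b : bimod S' j k) :
  val (linked_r x b) = bm_r (val x) (res_map lk' b).
Proof.
rewrite gateE // negb_and => /orP[iE|kE].
  by rewrite gated0 ?bm_r0l // negb_and iE.
by rewrite res_map_outr // bm_r0r.
Qed.

Lemma linked_lDl h i j (a b : bimod S h i) (x : linked i j) :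
  linked_l (a + b) x = linked_l a x + linked_l b x.
Proof. by apply: val_inj; rewrite linked_valD !linked_lE res_mapD bm_lDl. Qed.

Lemma linked_lDr h i j (a : bimod S h i) (x y : linked i j) :
  linked_l a (x + y) = linked_l a x + linked_l a y.
Proof. by apply: val_inj; rewrite linked_valD !linked_lE linked_valD bm_lDr. Qed.

Lemma linked_rDl i j k (x y : linked i j) (b : bimod S' j k) :
  linked_r (x + y) b = linked_r x b + linked_r y b.
Proof. by apply: val_inj; rewrite linked_valD !linked_rE linked_valD bm_rDl. Qed.

Lemma linked_rDr i j k (x : linked i j) (a b : bimod S' j k) :
  linked_r x (a + b) = linked_r x a + linked_r x b.
Proof. by apply: val_inj; rewrite linked_valD !linked_rE res_mapD bm_rDr. Qed.

Lemma linked_lA g h i j (a : bimod S g h) (b : bimod S h i) (x : linked i j) :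
  linked_l a (linked_l b x) = linked_l (fm_mul a b) x.
Proof. by apply: val_inj; rewrite !linked_lE res_mapM bm_lM. Qed.

Lemma linked_rA i j k l (x : linked i j) (a : bimod S' j k) (b : bimod S' k l) :
  linked_r x (fm_mul a b) = linked_r (linked_r x a) b.
Proof. by apply: val_inj; rewrite !linked_rE res_mapM bm_rM. Qed.

Lemma linked_lr h i j k (a : bimod S h i) (x : linked i j) (b : bimod S' j k) :
  linked_l a (linked_r x b) = linked_r (linked_l a x) b.
Proof. by apply: val_inj; rewrite linked_lE !linked_rE linked_lE bm_lr. Qed.

Lemma linked_l1 i j (x : linked i j) : linked_l (fm_one S i) x = x.
Proof.
apply: val_inj; have [iE|/negP iE] := pselect (i \in E); rewrite linked_lE.
  by rewrite res_map1 // bm_l1.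
have -> : val x = 0 by apply: gated0; rewrite negb_and iE.
exact: bm_l0r.
Qed.

Lemma linked_r1 i j (x : linked i j) : linked_r x (fm_one S' j) = x.
Proof.
apply: val_inj; have [jE|/negP jE] := pselect (j \in E'); rewrite linked_rE.
  by rewrite res_map1 // bm_r1.
have -> : val x = 0 by apply: gated0; rewrite negb_and jE orbT.
exact: bm_r0l.
Qed.

Lemma linked_neq0 i j (x : linked i j) : x != 0 -> (i \in E) /\ (j \in E').
Proof.
move=> x0; apply/andP; apply: contraNT x0 => ij.
by rewrite -val_eqE /= (gated0 x ij).
Qed.

End LinkedBimodule.

Section LinkedPairing.
Variables (I I' : finType) (S : fmring I) (S' : fmring I') (K L : pzRingType).
Variables (E : {set I}) (E' : {set I'}) (s : I -> I) (s' : I' -> I').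
Variables (lk : link S K E s) (lk' : link S' L E' s').
Variables (X : bimodule K L) (Y : bimodule L K) (p : pairing X Y).

Local Notation X_ := (linked E E' X).
Local Notation Y_ := (linked E' E Y).

Definition linked_pair i j k (x : X_ i j) (y : Y_ j k) : bimod S i k :=
  soc_map lk i k (p (val x) (val y)).

Lemma linked_pairDl i j k (x x' : X_ i j) (y : Y_ j k) :
  linked_pair (x + x') y = linked_pair x y + linked_pair x' y.
Proof. by rewrite /linked_pair linked_valD pairDl soc_mapD. Qed.

Lemma linked_pairDr i j k (x : X_ i j) (y y' : Y_ j k) :
  linked_pair x (y + y') = linked_pair x y + linked_pair x y'.
Proof. by rewrite /linked_pair linked_valD pairDr soc_mapD. Qed.

Lemma linked_pair_l h i j k (a : bimod S h i) (x : X_ i j) (y : Y_ j k) :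
  fm_mul a (linked_pair x y) = linked_pair (linked_l lk a x) y.
Proof. by rewrite /linked_pair linked_lE pairZl soc_map_l. Qed.

Lemma linked_pair_r i j k l (x : X_ i j) (y : Y_ j k) (a : bimod S k l) :
  linked_pair x (linked_r lk y a) = fm_mul (linked_pair x y) a.
Proof. by rewrite /linked_pair linked_rE pairZr soc_map_r. Qed.

Lemma linked_pair_mid i j k l (x : X_ i j) (a : bimod S' j k) (y : Y_ k l) :
  linked_pair x (linked_l lk' a y) = linked_pair (linked_r lk' x a) y.
Proof. by rewrite /linked_pair linked_lE linked_rE pair_mid. Qed.

Lemma linked_l_linked_pair i j k l (x : X_ i j) (y : Y_ j k) (z : X_ k l) :
  linked_l lk (linked_pair x y) z = 0.
Proof. by apply: val_inj; rewrite linked_lE res_soc_map bm_l0l. Qed.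

Lemma linked_r_linked_pair i j k l (y : Y_ i j) (x : X_ j k) (z : Y_ k l) :
  linked_r lk y (linked_pair x z) = 0.
Proof. by apply: val_inj; rewrite linked_rE res_soc_map bm_r0r. Qed.

Lemma linked_pair_ndl i j (x : X_ i j) :
  x != 0 -> exists y : Y_ j (s i), linked_pair x y != 0.
Proof.
move=> x0; have [iE jE] := linked_neq0 x0.
have [y xy] := pair_ndl p (x := val x) x0.
exists (gate _ y); rewrite /linked_pair gateE; first exact: soc_map_neq0.
by rewrite jE (link_stable lk) iE.
Qed.

Lemma linked_pair_ndr i j (y : Y_ j (s i)) :
  y != 0 -> exists x : X_ i j, linked_pair x y != 0.
Proof.
move=> y0; have [jE] := linked_neq0 y0; rewrite (link_stable lk) => iE.
have [x xy] := pair_ndr p (y := val y) y0.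
exists (gate _ x); rewrite /linked_pair gateE; first exact: soc_map_neq0.
by rewrite jE iE.
Qed.

End LinkedPairing.
Section Glue.
Variables (I I' : finType) (S : fmring I) (S' : fmring I') (K L : pzRingType).
Variables (E : {set I}) (E' : {set I'}) (s : I -> I) (s' : I' -> I').
Variables (lk : link S K E s) (lk' : link S' L E' s').
Variables (X : bimodule K L) (Y : bimodule L K) (p : pairing X Y) (q : pairing Y X).

Definition glue_bimod (u v : I + I') : zmodType :=
  match u, v with
  | inl i, inl j => bimod S i j
  | inl i, inr j => linked E E' X i j
  | inr i, inl j => linked E' E Y i j
  | inr i, inr j => bimod S' i j
  end.

Definition glue_one (u : I + I') : glue_bimod u u :=
  match u with inl i => fm_one S i | inr i => fm_one S' i end.

Definition glue_mul (u v w : I + I') :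
    glue_bimod u v -> glue_bimod v w -> glue_bimod u w :=
  match u, v, w with
  | inl i, inl j, inl k => fun a b => fm_mul a b
  | inl i, inl j, inr k => fun a x => linked_l lk a x
  | inl i, inr j, inl k => fun x y => linked_pair lk p x y
  | inl i, inr j, inr k => fun x b => linked_r lk' x b
  | inr i, inl j, inl k => fun y a => linked_r lk y a
  | inr i, inl j, inr k => fun y x => linked_pair lk' q y x
  | inr i, inr j, inl k => fun b y => linked_l lk' b y
  | inr i, inr j, inr k => fun a b => fm_mul a b
  end.

Definition glue_data : fmdata (I + I')%type.
Proof.
refine (@FMData _ glue_bimod glue_one glue_mul _ _ _ _ _).
- case=> i [] j [] k; [exact: fm_mulDl | exact: linked_lDl | exact: linked_pairDl
    | exact: linked_rDl | exact: linked_rDl | exact: linked_pairDl | exact: linked_lDl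
    | exact: fm_mulDl].
- case=> i [] j [] k; [exact: fm_mulDr | exact: linked_lDr | exact: linked_pairDr
    | exact: linked_rDr | exact: linked_rDr | exact: linked_pairDr | exact: linked_lDr
    | exact: fm_mulDr].
- case=> i [] j [] k [] l.
  + exact: fm_mulA.
  + exact: linked_lA.
  + exact: linked_pair_l.
  + exact: linked_lr.
  + exact: linked_pair_r.
  (* Both (x y) x' and x (y x') are zero, as [res_map] kills the values of
     the pairings. *)
  + by move=> x y z; rewrite /= linked_l_linked_pair linked_r_linked_pair.
  + exact: linked_pair_mid.
  + exact: linked_rA.
  + exact: linked_rA.
  + exact: linked_pair_mid.
  + by move=> x y z; rewrite /= linked_l_linked_pair linked_r_linked_pair.
  + exact: linked_pair_r.
  + exact: linked_lr.
  + exact: linked_pair_l.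
  + exact: linked_lA.
  + exact: fm_mulA.
- case=> i [] j; [exact: fm_mul1l | exact: linked_l1 | exact: linked_l1 | exact: fm_mul1l].
- case=> i [] j; [exact: fm_mul1r | exact: linked_r1 | exact: linked_r1 | exact: fm_mul1r].
Defined.

Definition glue : fmring (I + I')%type :=
  @FMRing _ glue_data
    (fun u => match u with inl i => fm_local S i | inr i => fm_local S' i end).

Hypotheses (bas : basic_elt S) (bas' : basic_elt S').
Hypothesis K1 : (1 : K) != 0.

Lemma glue_basic : basic_elt glue.
Proof.
(* A product of entries between the two rings has residue zero. *)
have linked_pair_one : forall i j (x : linked E E' X i j) (y : linked E' E Y j i),
    linked_pair lk p x y <> fm_one S i.
  move=> i j x y; have [iE|/negP iE] := pselect (i \in E).
    move/(congr1 (res_map lk (h := i) (i := i)));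
    rewrite res_soc_map res_map1 // => /esym/eqP.
    exact/negP.
  have -> : x = 0.
    by apply/eqP/negPn/negP => /linked_neq0[iE']; rewrite iE' in iE.
  rewrite /linked_pair raddf0 pair0l soc_map0 => /esym/eqP; exact/negP/fm_one_neq0.
case=> [i [j ij|j _]|i [j _|j ij]].
- by apply: bas.
- by move=> a b [/linked_pair_one].
- by move=> a b [_ /linked_pair_one].
- by apply: bas'.
Qed.

Lemma glue_cross_radical : forall i j,
  (forall x : bimod glue (inl i) (inr j), radical_elt x) /\
  (forall y : bimod glue (inr j) (inl i), radical_elt y).
Proof. by move=> i j; split=> x; apply: (basic_radical glue_basic). Qed.

(** A nonzero element of a coordinate bimodule between the two rings pairs with
    an element of the opposite one to a nonzero value, and that one is in the
    radical; so the gluing adds nothing to the socles. *)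
Lemma cross_right_socle i j (x : bimod glue (inl i) (inr j)) :
  right_socle_elt x -> x = 0.
Proof.
move=> hx; apply/eqP/negPn/negP => /(linked_pair_ndl lk p)[y /eqP[]].
by apply: (hx (inl (s i)) y); have [_] := glue_cross_radical (s i) j; apply.
Qed.

Lemma cross_left_socle i j (y : bimod glue (inr j) (inl (s i))) :
  left_socle_elt y -> y = 0.
Proof.
move=> hy; apply/eqP/negPn/negP => /(linked_pair_ndr lk p)[x /eqP[]].
by apply: (hy (inl i) x); have [h _] := glue_cross_radical i j; apply: h.
Qed.

Lemma cross_right_socle' i j (y : bimod glue (inr j) (inl i)) :
  right_socle_elt y -> y = 0.
Proof.
move=> hy; apply/eqP/negPn/negP => /(linked_pair_ndl lk' q)[x /eqP[]].
by apply: (hy (inr (s' j)) x); have [h _] := glue_cross_radical i (s' j); apply: h.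
Qed.

Lemma cross_left_socle' i j (x : bimod glue (inl i) (inr (s' j))) :
  left_socle_elt x -> x = 0.
Proof.
move=> hx; apply/eqP/negPn/negP => /(linked_pair_ndr lk' q)[y /eqP[]].
by apply: (hx (inr j) y); have [_] := glue_cross_radical i j; apply.
Qed.

(** Socle elements of the two rings are killed by [res_map], hence by the coordinate
    bimodules between the two rings. *)
Lemma glue_right_socle i k (u : bimod S i k) :
  @right_socle_elt _ glue (inl i) (inl k) u <-> right_socle_elt u.
Proof.
split=> [hu l b hb|hu]; first exact: (hu (inl l) b hb).
case=> l b hb; first exact: hu.
by apply: val_inj; rewrite linked_lE (res_map_right_socle lk hu) bm_l0l.
Qed.

Lemma glue_right_socle' i k (u : bimod S' i k) :
  @right_socle_elt _ glue (inr i) (inr k) u <-> right_socle_elt u.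
Proof.
split=> [hu l b hb|hu]; first exact: (hu (inr l) b hb).
case=> l b hb; last exact: hu.
by apply: val_inj; rewrite linked_lE (res_map_right_socle lk' hu) bm_l0l.
Qed.

Lemma glue_left_socle i k (u : bimod S k (s i)) :
  @left_socle_elt _ glue (inl k) (inl (s i)) u <-> left_socle_elt u.
Proof.
split=> [hu l b hb|hu]; first exact: (hu (inl l) b hb).
case=> l b hb; first exact: hu.
by apply: val_inj; rewrite linked_rE (res_map_left_socle lk hu) bm_r0r.
Qed.

Lemma glue_left_socle' i k (u : bimod S' k (s' i)) :
  @left_socle_elt _ glue (inr k) (inr (s' i)) u <-> left_socle_elt u.
Proof.
split=> [hu l b hb|hu]; first exact: (hu (inr l) b hb).
case=> l b hb; last exact: hu.
by apply: val_inj; rewrite linked_rE (res_map_left_socle lk' hu) bm_r0r.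
Qed.

Definition sum_fun (u : I + I') : I + I' :=
  match u with inl i => inl (s i) | inr i => inr (s' i) end.

Lemma glue_nakayama :
  nakayama_elt S s -> nakayama_elt S' s' -> nakayama_elt glue sum_fun.
Proof.
move=> nak nak' [] i.
  have [[t [t0 ht tgen]] [r [r0 hr rgen]]] := nak i; split.
    exists t; split=> //; first exact/glue_right_socle.
    case=> k u hu; first exact/tgen/glue_right_socle.
    by exists 0; rewrite (cross_right_socle hu) fm_mul0r.
  exists r; split=> //; first exact/glue_left_socle.
  case=> k u hu; first exact/rgen/glue_left_socle.
  by exists 0; rewrite (cross_left_socle hu) fm_mul0l.
have [[t [t0 ht tgen]] [r [r0 hr rgen]]] := nak' i; split.
  exists t; split=> //; first exact/glue_right_socle'.
  case=> k u hu; last exact/tgen/glue_right_socle'.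
  by exists 0; rewrite (cross_right_socle' hu) fm_mul0r.
exists r; split=> //; first exact/glue_left_socle'.
case=> k u hu; last exact/rgen/glue_left_socle'.
by exists 0; rewrite (cross_left_socle' hu) fm_mul0l.
Qed.

Lemma glue_essential : essential_elt glue <-> essential_elt S /\ essential_elt S'.
Proof.
split=> [ess|[ess ess']].
  split=> i j x x0.
    have [[] k [a [xa0 xas]]] := ess (inl i) (inl j) x x0.
      by exists k, a; split=> //; apply/glue_right_socle.
    by case/eqP: xa0; apply: cross_right_socle xas.
  have [[] k [a [xa0 xas]]] := ess (inr i) (inr j) x x0.
    by case/eqP: xa0; apply: cross_right_socle' xas.
  by exists k, a; split=> //; apply/glue_right_socle'.
case=> i [] j x x0.
- have [k [a [xa0 xas]]] := ess i j x x0.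
  by exists (inl k), a; split=> //; apply/glue_right_socle.
- have [y xy0] := linked_pair_ndl lk p x0.
  exists (inl (s i)), y; split=> //; apply/glue_right_socle.
  exact: right_socle_soc_map.
- have [y xy0] := linked_pair_ndl lk' q x0.
  exists (inr (s' i)), y; split=> //; apply/glue_right_socle'.
  exact: right_socle_soc_map.
have [k [a [xa0 xas]]] := ess' i j x x0.
by exists (inr k), a; split=> //; apply/glue_right_socle'.
Qed.

(** A union of blocks contains all or nothing of each ring, and the nonzero
    coordinate bimodules between E and E' exclude that it is one of them. *)
Lemma glue_connected : connected_elt S -> connected_elt S' ->
  E != set0 -> E' != set0 -> (exists x : X, x != 0) -> connected_elt glue.
Proof.
move=> conn conn' /set0Pn[i iE] /set0Pn[j jE] [x x0] U hU.
have c1 := conn [set k | inl k \in U] _; have c2 := conn' [set k | inr k \in U] _.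
have {}c1 : [set k | inl k \in U] = set0 \/ [set k | inl k \in U] = setT.
  by apply: c1 => k l; rewrite !inE => kU lU; apply: (hU (inl k) (inl l)).
have {}c2 : [set k | inr k \in U] = set0 \/ [set k | inr k \in U] = setT.
  by apply: c2 => k l; rewrite !inE => kU lU; apply: (hU (inr k) (inr l)).
have mem1 k : (inl k \in U) = (k \in [set k | inl k \in U]) by rewrite inE.
have mem2 k : (inr k \in U) = (k \in [set k | inr k \in U]) by rewrite inE.
pose x' : linked E E' X i j := gate _ x.
have x'0 : x' != 0 by rewrite -val_eqE /= iE jE.
have same : (inl i \in U) = (inr j \in U).
  apply/idP/idP; apply: contraTT => h; apply/negP => h'; case/eqP: x'0.
    exact: (hU (inl i) (inr j) h' h).1.
  exact: (hU (inr j) (inl i) h' h).2.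
move: same; rewrite mem1 mem2.
case: c1 c2 mem1 mem2 => -> [] -> mem1 mem2; rewrite ?inE // => _; [left | right].
  by apply/setP => -[] k; rewrite ?mem1 ?mem2 !inE.
by apply/setP => -[] k; rewrite ?mem1 ?mem2 !inE.
Qed.

End Glue.
(** * The link of a ring with its residue skew field *)

Lemma local_frame (R : pzRingType) : local_ring R ->
  basic_frame (fun _ : unit => 1 : R) (jacobson R).
Proof.
move=> locR; split.
- exact: (@rpred0 _ (jacobson_submod R)).
- by move=> x y hx hy; apply: (@rpredD _ (jacobson_submod R)).
- by move=> a x; apply: jacobsonMl.
- by move=> a x; apply: jacobsonMr.
- by move=> _; rewrite mulr1.
- by rewrite big_const card_unit /= addr0.
- by move=> _; apply: local_1_notin_jacobson.
- by move=> [] [].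
by move=> _ a; rewrite mul1r mulr1 => /(local_left_inverse locR).
Qed.

Lemma local_frame_converse (R : pzRingType) : local_ring R ->
  @basic_frame R^c _ (fun _ : unit => 1 : R) (jacobson R).
Proof.
move=> locR; have fr := local_frame locR; split.
- exact: frame0 fr.
- exact: frameD fr.
- exact: frameMr fr.
- exact: frameMl fr.
- exact: frame_idem fr.
- exact: frame_sum fr.
- exact: frame_notin fr.
- by move=> [] [].
move=> _ a; have -> : (1 * a * 1 : R^c) = a by rewrite mul1r mulr1.
by move=> /(local_unit locR)[b [_ ab]]; exists b.
Qed.

Section PairingSocles.
Variables (I : finType) (S : fmring I) (s : {perm I}).
Hypothesis bas : basic_elt S.

Lemma left_socle_pairing i (t : bimod S i (s i)) :
  left_socle_elt t -> pairing_Tl S s i t.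
Proof.
move=> ht.
have tP : (t : lbimod S i (s i)) \in Submod (@left_annihilated_closed _ S s i).
  by apply/asboolP=> h hi b; apply: ht; apply: basic_radical.
exists (Sub (t : lbimod S i (s i)) tP : submod_type _) => //.
apply/(socleP (local_frame (fm_local S i))) => a aJ; apply/val_scale_eq0 => /=.
by apply: ht; apply/corner_jacobsonP.
Qed.

Lemma right_socle_pairing i (t : bimod S i (s i)) :
  right_socle_elt t -> pairing_Tr S s i t.
Proof.
move=> ht.
have tP : (t : rbimod S i (s i)) \in Submod (@right_annihilated_closed _ S s i).
  by apply/asboolP=> h hi b; apply: ht; apply: basic_radical => //; rewrite eq_sym.
exists (Sub (t : rbimod S i (s i)) tP : submod_type _) => //.
apply/(socleP (local_frame_converse (fm_local S (s i)))) => a aJ.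
apply/val_scale_eq0 => /=.
by apply: ht; apply/corner_jacobsonP.
Qed.

End PairingSocles.

Section ExistsLink.
Variables (I : finType) (S : fmring I) (s : {perm I}) (E : {set I}).
Variables (rho : {perm {i : I | i \in E}}) (K : nzRingType).
Let P := fm_restrict S E.
Variable theta : forall i, {rmorphism residue (corner P i) -> K}.
Hypotheses (bas : basic_elt S) (nak : nakayama_elt S s).
Hypotheses (rho_restr : forall i, val (rho i) = s (val i)).
Hypotheses (K_skew : skew_field K) (theta_bij : forall i, bijective (theta i)).
Hypothesis (T_eq : forall i m, pairing_Tr P rho i m <-> pairing_Tl P rho i m).
Hypothesis (T_iso : forall i, pairing_Tl_iso P rho K theta i).
Hypothesis (not_simple : forall i, rho i = i -> ~ simple_ring (corner P i)).

Let J := {i : I | i \in E}.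

Definition residue_map (i : J) (a : bimod S (val i) (val i)) : K :=
  theta i (residue_pi (a : corner P i)).

Arguments residue_map i a : clear implicits.

Lemma residue_map_eq0 i a : residue_map i a = 0 <-> radical_elt a.
Proof.
have th_inj := bij_inj (theta_bij i).
have pi0 : residue_pi (0 : corner P i) = 0.
  by apply: (addIr (residue_pi (0 : corner P i))); rewrite -residue_piD !add0r.
rewrite /residue_map; split=> [h|ha].
  have /quomod_piP : residue_pi (a : corner P i) = residue_pi 0.
    by apply: th_inj; rewrite h pi0 rmorph0.
  by rewrite subr0 => /(local_jacobsonP (fm_local P i)).
have -> : residue_pi (a : corner P i) = residue_pi 0.
  by apply/quomod_piP; rewrite subr0; apply/(local_jacobsonP (fm_local P i)).
by rewrite pi0 rmorph0.
Qed.

Lemma residue_map_surj i c : exists a, residue_map i a = c.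
Proof.
have [th _ thK] := theta_bij i; have [a aE] := residue_pi_surj (th c).
by exists a; rewrite /residue_map -aE thK.
Qed.

Definition residue_entry h i (a : bimod S h i) : K :=
  match i =P h, @idP (h \in E) with
  | ReflectT ih, ReflectT hE =>
      residue_map (exist _ h hE) (eq_rect i (bimod S h) a h ih)
  | _, _ => 0
  end.

Lemma residue_entry_in (i : J) (a : bimod S (val i) (val i)) :
  residue_entry a = residue_map i a.
Proof.
rewrite /residue_entry; case: eqP => // e;
case: {-}_ / idP => [iE|]; last by rewrite (valP i).
rewrite eq_axiomK /=; case: i a e iE => i iE0 /= a e iE.
by rewrite (bool_irrelevance iE iE0).
Qed.

Lemma residue_entry_neq h i (a : bimod S h i) : h != i -> residue_entry a = 0.
Proof. by rewrite /residue_entry; case: eqP => // e /eqP[]. Qed.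

Lemma residue_entry_out h i (a : bimod S h i) : h \notin E -> residue_entry a = 0.
Proof.
move=> hE0; rewrite /residue_entry; case: eqP => // e; case: {-}_ / idP => // hE.
by case/negP: hE0.
Qed.

Definition pairing_embed (i : J) :
  {additive K -> bimod S (val i) (val (rho i))} :=
  projT1 (cid (T_iso i)).

Lemma pairing_embedP (i : J) : [/\ injective (pairing_embed i),
  forall m, pairing_Tl P rho i m <-> exists x, pairing_embed i x = m,
  forall (a : corner P i) x,
    pairing_embed i (residue_map i a * x) = fm_mul a (pairing_embed i x) &
  forall (b : corner P (rho i)) x,
    pairing_embed i (x * residue_map (rho i) b) = fm_mul (pairing_embed i x) b].
Proof. by rewrite /pairing_embed; case: cid. Qed.

Definition socle_entry i k (c : K) : bimod S i k :=
  match @idP (i \in E) with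
  | ReflectT iE => match val (rho (exist _ i iE)) =P k with
    | ReflectT e => eq_rect _ (bimod S i) (pairing_embed (exist _ i iE) c) k e
    | ReflectF _ => 0
    end
  | ReflectF _ => 0
  end.

Lemma socle_entry_in (i : J) c :
  socle_entry (val i) (val (rho i)) c = pairing_embed i c.
Proof.
rewrite /socle_entry; case: {-}_ / idP => [iE|]; last by rewrite (valP i).
case: i iE => i iE0 /= iE; rewrite (bool_irrelevance iE iE0).
by case: eqP => // e; rewrite eq_axiomK.
Qed.

Lemma socle_entry_neq (i : J) k c :
  val (rho i) != k -> socle_entry (val i) k c = 0.
Proof.
rewrite /socle_entry; case: {-}_ / idP => [iE|//].
case: i iE => i iE0 /= iE; rewrite (bool_irrelevance iE iE0).
by case: eqP => // e /eqP[].
Qed.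

Lemma socle_entry_out i k c : i \notin E -> socle_entry i k c = 0.
Proof.
by move=> iE0; rewrite /socle_entry; case: {-}_ / idP => // iE; case/negP: iE0.
Qed.

Lemma index_ind (Q : I -> Prop) :
  (forall i : J, Q (val i)) -> (forall i, i \notin E -> Q i) -> forall i, Q i.
Proof.
move=> h1 h2 i; have [iE|] := boolP (i \in E); last exact: h2.
exact: (h1 (exist _ i iE)).
Qed.

Lemma socle_entry0 i k : socle_entry i k 0 = 0.
Proof.
elim/index_ind: i => [i|i iE]; last exact: socle_entry_out.
have [<-|] := eqVneq (val (rho i)) k; last exact: socle_entry_neq.
by rewrite socle_entry_in raddf0.
Qed.

Lemma residue_mapD i a b :
  residue_map i (a + b) = residue_map i a + residue_map i b.
Proof. by rewrite /residue_map -rmorphD -residue_piD. Qed.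

Lemma residue_mapM i a b :
  residue_map i (fm_mul a b) = residue_map i a * residue_map i b.
Proof.
by rewrite /residue_map -rmorphM -[RHS]/(theta i (residue_mul _ _)) residue_piM.
Qed.

Lemma residue_entryD h i (a b : bimod S h i) :
  residue_entry (a + b) = residue_entry a + residue_entry b.
Proof.
elim/index_ind: h a b => [h a b|h hE a b]; last by rewrite !residue_entry_out // addr0.
have [e|hi] := eqVneq (val h) i; last by rewrite !residue_entry_neq // addr0.
by move: a b; rewrite -e => a b; rewrite !residue_entry_in residue_mapD.
Qed.

Lemma residue_entry_radical h i (a : bimod S h i) :
  radical_elt a -> residue_entry a = 0.
Proof.
elim/index_ind: h a => [h a|h hE a _]; last exact: residue_entry_out.
have [e|hi _] := eqVneq (val h) i; last exact: residue_entry_neq.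
by move: a; rewrite -e => a /residue_map_eq0; rewrite residue_entry_in.
Qed.

Lemma residue_entryM h i j (a : bimod S h i) (b : bimod S i j) :
  residue_entry (fm_mul a b) = residue_entry a * residue_entry b.
Proof.
elim/index_ind: h a => [h a|h hE a]; last first.
  by rewrite [LHS]residue_entry_out // [residue_entry a]residue_entry_out // mul0r.
have [e|hi] := eqVneq (val h) i; last first.
  rewrite [residue_entry a]residue_entry_neq // mul0r; apply: residue_entry_radical.
  by apply: radical_mulr; apply: basic_radical.
move: a b; rewrite -e => a b; have [e'|hj] := eqVneq (val h) j; last first.
  by rewrite [residue_entry b]residue_entry_neq // mulr0 residue_entry_neq.
by move: b; rewrite -e' => b; rewrite !residue_entry_in residue_mapM.
Qed.

Lemma residue_entry1 i : i \in E -> residue_entry (fm_one S i) = 1.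
Proof.
move=> iE; rewrite -[i]/(val (exist _ i iE : J)) residue_entry_in.
(* A nonzero idempotent of a skew field is 1. *)
set c := residue_map _ _.
have cc : c * c = c by rewrite -residue_mapM fm_mul1l.
have c0 : c != 0.
  by apply/eqP => /residue_map_eq0 /(_ (fm_one S i)); rewrite fm_mul1l.
have [d [dc _]] := K_skew.2 c c0.
by rewrite -[c]mul1r -dc -mulrA cc.
Qed.

Lemma residue_entry_outr h i (a : bimod S h i) :
  i \notin E -> residue_entry a = 0.
Proof.
move=> iE; have [hi|hi] := eqVneq h i; last exact: residue_entry_neq.
by apply: residue_entry_out; rewrite hi.
Qed.

Lemma socle_entryD i k c d :
  socle_entry i k (c + d) = socle_entry i k c + socle_entry i k d.
Proof.
elim/index_ind: i => [i|i iE]; last by rewrite !socle_entry_out // addr0.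
have [<-|ne] := eqVneq (val (rho i)) k; last by rewrite !socle_entry_neq // addr0.
by rewrite !socle_entry_in raddfD.
Qed.

(** The socle generators of [S] at a position (i, s i) with i in E lie in the
    socles of the pairing bimodule of e S e, hence in the image of K. *)
Lemma pairing_embed_left_generator (i : J) :
  exists2 c, c != 0 & left_socle_generator (pairing_embed i c).
Proof.
have [_ im _ _] := pairing_embedP i.
have := (nak (val i)).2; rewrite -rho_restr => -[t [t0 ht tgen]].
have /im[c cE] : pairing_Tl P rho i t.
  apply: (@left_socle_pairing _ P rho) => [h k hk a b ab|h a ha].
    by apply: (bas (i := val h) (j := val k) _ ab); rewrite (inj_eq val_inj).
  exact: (ht (val h) a ha).
by exists c; rewrite ?cE //; apply: contraNneq t0 => c0; rewrite -cE c0 raddf0.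
Qed.

Lemma pairing_embed_right_generator (i : J) :
  exists2 c, c != 0 & right_socle_generator (pairing_embed i c).
Proof.
have [_ im _ _] := pairing_embedP i.
have := (nak (val i)).1; rewrite -rho_restr => -[t [t0 ht tgen]].
have /T_eq/im[c cE] : pairing_Tr P rho i t.
  apply: (@right_socle_pairing _ P rho) => [h k hk a b ab|h a ha].
    by apply: (bas (i := val h) (j := val k) _ ab); rewrite (inj_eq val_inj).
  exact: (ht (val h) a ha).
by exists c; rewrite ?cE //; apply: contraNneq t0 => c0; rewrite -cE c0 raddf0.
Qed.

Lemma pairing_embed_left_socle (i : J) c : left_socle_elt (pairing_embed i c).
Proof.
have [_ _ lin _] := pairing_embedP i.
have [c0 c00 [_ hc0 _]] := pairing_embed_left_generator i.
have [d [dc _]] := K_skew.2 c0 c00; have [a aE] := residue_map_surj i (c * d).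
by rewrite -[c]mulr1 -dc mulrA -aE lin; apply: left_socle_mull.
Qed.

Lemma pairing_embed_right_socle (i : J) c : right_socle_elt (pairing_embed i c).
Proof.
have [_ _ _ lin] := pairing_embedP i.
have [c0 c00 [_ hc0 _]] := pairing_embed_right_generator i.
have [d [_ cd]] := K_skew.2 c0 c00; have [a aE] := residue_map_surj (rho i) (d * c).
by rewrite -[c]mul1r -cd -mulrA -aE lin; apply: right_socle_mulr.
Qed.

(** A left socle element outside the radical is a unit of a corner annihilated by
    the radical of the corner. *)
Lemma residue_entry_left_socle h k (u : bimod S h k) :
  left_socle_elt u -> residue_entry u != 0 ->
  h = k /\ simple_ring (corner S h).
Proof.
move=> hu u0; have hk : h = k by apply/eqP; apply: contraNT u0 => /residue_entry_neq->.
split=> //; apply: (local_simple (fm_local S h)) => a /corner_jacobsonP ha.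
have [b ub] : exists b : bimod S k h, fm_mul u b = fm_one S h.
  apply: contrapT => nb; case/eqP: u0; apply: residue_entry_radical => b ub.
  by apply: nb; exists b.
by rewrite -[LHS](fm_mul1r (a : bimod S h h)) -ub fm_mulA hu // fm_mul0l.
Qed.

Lemma residue_socle_entry i k c : residue_entry (socle_entry i k c) = 0.
Proof.
elim/index_ind: i => [i|i iE]; last by apply: residue_entry_out.
have [<-|ne] := eqVneq (val (rho i)) k; last first.
  by rewrite socle_entry_neq //; apply: residue_entry_radical; apply: radical0.
rewrite socle_entry_in; apply/eqP/negPn/negP.
case/(residue_entry_left_socle (@pairing_embed_left_socle i c)) => /val_inj/esym e.
exact: not_simple.
Qed.

Lemma socle_entry_l h i k (a : bimod S h i) c :
  fm_mul a (socle_entry i k c) = socle_entry h k (residue_entry a * c).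
Proof.
elim/index_ind: i a => [i a|i iE a]; last first.
  by rewrite socle_entry_out // fm_mul0r residue_entry_outr // mul0r socle_entry0.
have [hi|hi] := eqVneq h (val i); last first.
  rewrite [residue_entry a]residue_entry_neq // mul0r socle_entry0.
  have [<-|ne] := eqVneq (val (rho i)) k; last by rewrite socle_entry_neq // fm_mul0r.
  by rewrite socle_entry_in pairing_embed_left_socle //; apply: basic_radical.
move: a; rewrite hi => a.
have [<-|ne] := eqVneq (val (rho i)) k; last by rewrite !socle_entry_neq // fm_mul0r.
by have [_ _ lin _] := pairing_embedP i; rewrite !socle_entry_in residue_entry_in lin.
Qed.

Lemma socle_entry_r i k l c (a : bimod S k l) :
  fm_mul (socle_entry i k c) a = socle_entry i l (c * residue_entry a).
Proof.
elim/index_ind: i => [i|i iE]; last by rewrite !socle_entry_out // fm_mul0l.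
have [e|ne] := eqVneq (val (rho i)) k; last first.
  rewrite socle_entry_neq // fm_mul0l; have [kl|kl] := eqVneq k l.
    by rewrite socle_entry_neq // -kl.
  by rewrite [residue_entry a]residue_entry_neq // mulr0 socle_entry0.
move: a; rewrite -e => a; rewrite socle_entry_in.
have [kl|kl] := eqVneq (val (rho i)) l; last first.
  rewrite [residue_entry a]residue_entry_neq // mulr0 socle_entry0.
  by apply: pairing_embed_right_socle; apply: basic_radical.
move: a; rewrite -kl => a; rewrite socle_entry_in residue_entry_in.
by have [_ _ _ lin] := pairing_embedP i; rewrite lin.
Qed.

Lemma socle_entry_neq0 i c : i \in E -> c != 0 -> socle_entry i (s i) c != 0.
Proof.
elim/index_ind: i => [i _|i /negP//]; rewrite -rho_restr socle_entry_in.
have [g_inj _ _ _] := pairing_embedP i; apply: contraNneq => h.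
by apply/eqP/g_inj; rewrite h raddf0.
Qed.

Lemma socle_entry_right_socle i k (u : bimod S i k) :
  i \in E -> right_socle_elt u ->
  exists c, u = socle_entry i k c.
Proof.
elim/index_ind: i u => [i u _ hu|i /negP//].
have [c _ [_ _ /(_ k u hu)[b ->]]] := pairing_embed_right_generator i.
by exists (c * residue_entry b); rewrite -socle_entry_r socle_entry_in.
Qed.

Lemma socle_entry_left_socle i k (u : bimod S k (s i)) :
  i \in E -> left_socle_elt u ->
  exists c, u = socle_entry k (s i) c.
Proof.
elim/index_ind: i u => [i|i /negP//]; rewrite -rho_restr => u _ hu.
have [c _ [_ _ /(_ k u hu)[a ->]]] := pairing_embed_left_generator i.
by exists (residue_entry a * c); rewrite -socle_entry_l socle_entry_in.
Qed.

Lemma index_stable i : (s i \in E) = (i \in E).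
Proof.
apply/idP/idP => [siE|iE].
  have := rho_restr (perm_inv rho (exist _ (s i) siE)).
  by rewrite permKV => /perm_inj ->; exact: (proj2_sig (perm_inv rho _)).
rewrite -[i]/(val (exist _ i iE : J)) -rho_restr; exact: (proj2_sig (rho _)).
Qed.

Definition residue_link : link S K E s :=
  Link residue_entryD residue_entryM residue_entry1 residue_entry_out
    residue_entry_outr residue_entry_radical socle_entryD socle_entry_l
    socle_entry_r residue_socle_entry socle_entry_neq0 socle_entry_right_socle
    socle_entry_left_socle index_stable.

End ExistsLink.
(** * The ring indexed by the concatenated index set *)

Section PullbackEntries.
Variables (I J : finType) (S : fmring I) (g : J -> I) (h : I -> J).
Hypotheses (gK : cancel g h) (hK : cancel h g).

Local Notation T := (fm_pullback S g).

Lemma pullback_basic : basic_elt S -> basic_elt T.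
Proof. by move=> bas i j ij a b; apply: bas; rewrite (can_eq gK). Qed.

Lemma pullback_right_socle i k (u : bimod T i k) :
  right_socle_elt u <-> @right_socle_elt _ S (g i) (g k) u.
Proof.
split=> hu l b hb; last exact: hu.
by move: b hb; rewrite -(hK l) => b hb; apply: (hu (h l) b hb).
Qed.

Lemma pullback_left_socle i k (u : bimod T k i) :
  left_socle_elt u <-> @left_socle_elt _ S (g k) (g i) u.
Proof.
split=> hu l b hb; last exact: hu.
by move: b hb; rewrite -(hK l) => b hb; apply: (hu (h l) b hb).
Qed.

Lemma pullback_nakayama (s : I -> I) (t : J -> J) :
  (forall j, g (t j) = s (g j)) -> nakayama_elt S s -> nakayama_elt T t.
Proof.
move=> gt nak j; have := nak (g j); rewrite -gt.
move=> [[u [u0 hu ugen]] [v [v0 hv vgen]]]; split.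
  exists u; split=> [||k w /pullback_right_socle/ugen] //.
  exact/pullback_right_socle.
exists v; split=> [||k w /pullback_left_socle/vgen] //.
exact/pullback_left_socle.
Qed.

Lemma pullback_essential : essential_elt T <-> essential_elt S.
Proof.
split=> [ess i j|ess i j x x0].
  rewrite -(hK i) -(hK j) => x x0; have [k [a [xa0 xas]]] := ess _ _ x x0.
  by exists (g k), a; split=> //; apply/pullback_right_socle.
have [k] := ess _ _ x x0; rewrite -(hK k) => -[a [xa0 xas]].
by exists (h k), a; split=> //; apply/pullback_right_socle.
Qed.

Lemma pullback_connected : connected_elt S -> connected_elt T.
Proof.
move=> conn U hU.
have [i j|U0|UT] := conn [set i | h i \in U].
- rewrite !inE => iU jU.
  have : (forall a : bimod S (g (h i)) (g (h j)), a = 0) /\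
         (forall a : bimod S (g (h j)) (g (h i)), a = 0) := hU _ _ iU jU.
  by rewrite !hK.
- by left; apply/setP => j; move/setP/(_ (g j)): U0; rewrite !inE gK.
- by right; apply/setP => j; move/setP/(_ (g j)): UT; rewrite !inE gK.
Qed.

End PullbackEntries.

Lemma fmx_iso (I : finType) (T T' : fmdata I)
    (F : forall i j, bimod T i j -> bimod T' i j)
    (G : forall i j, bimod T' i j -> bimod T i j) :
  (forall i j (a b : bimod T i j), F i j (a + b) = F i j a + F i j b) ->
  (forall i, F i i (fm_one T i) = fm_one T' i) ->
  (forall i j k (a : bimod T i j) (b : bimod T j k),
    F i k (fm_mul a b) = fm_mul (F i j a) (F j k b)) ->
  (forall i j, cancel (F i j) (G i j)) -> (forall i j, cancel (G i j) (F i j)) ->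
  ring_iso (fmx T) (fmx T').
Proof.
move=> FD F1 FM FK GK.
have F0 i j : F i j 0 = 0 by apply: (addIr (F i j 0)); rewrite -FD !add0r.
pose f (A : fmx T) : fmx T' := mkfmx (fun i j => F i j (entry A i j)).
have fB : zmod_morphism f.
  move=> A B; apply: fmxP => i j; rewrite entryD entryN !mkfmxE.
  apply: (addIr (F i j (entry B i j))); rewrite subrK -FD; congr (F i j _).
  by rewrite subrK.
have fM : monoid_morphism f.
  split=> [|A B]; apply: fmxP => i j.
    rewrite mkfmxE; have [<-|ij] := eqVneq i j; first by rewrite !entry1 F1.
    by rewrite !entry1_neq.
  rewrite mkfmxE !entryM (big_morph (F i j) (@FD i j) (F0 i j)).
  by apply: eq_bigr => k _; rewrite FM !mkfmxE.
pose fA := GRing.isZmodMorphism.Build _ _ f fB.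
pose fX := GRing.isMonoidMorphism.Build _ _ f fM.
pose f' : {rmorphism fmx T -> fmx T'} := HB.pack f fA fX.
exists f'; exists (fun A => mkfmx (fun i j => G i j (entry A i j))) => A;
  by apply: fmxP => i j; rewrite !mkfmxE ?FK ?GK.
Qed.

Section Concatenation.
Variables (n n' : nat) (S : fmring 'I_n) (S' : fmring 'I_n').
Variables (K L : pzRingType) (E : {set 'I_n}) (E' : {set 'I_n'}).
Variables (s : 'I_n -> 'I_n) (s' : 'I_n' -> 'I_n').
Variables (lk : link S K E s) (lk' : link S' L E' s').
Variables (X : bimodule K L) (Y : bimodule L K) (p : pairing X Y) (q : pairing Y X).

Definition concat_ring : fmring 'I_(n + n') :=
  fm_pullback (glue lk lk' p q) (@split n n').

Definition concat_idem : idem_elt (fmx concat_ring) :=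
  canon_sum concat_ring [set lshift n' i | i : 'I_n].

Lemma concat_left_corner : ring_iso (peirce concat_idem) (fmx S).
Proof.
have := @peirce_pullback _ _ concat_ring (lshift n') (@lshift_inj n n') concat_idem erefl.
move=> /ring_iso_trans; apply.
pose D := glue lk lk' p q.
(* Once the two index maps are equal as functions, the entries are in the same
   groups by definition and need no transport. *)
change (ring_iso (fmx (fm_pullback D (fun i => split (lshift n' i)))) (fmx S)).
have -> : (fun i : 'I_n => split (lshift n' i)) = inl.
  by apply/funext => i; apply: (unsplitK (inl i)).
by apply: (@fmx_iso _ (fm_pullback D inl) S (fun i j a => a) (fun i j a => a)).
Qed.

Lemma concat_right_corner : ring_iso (peirce (idem_compl concat_idem)) (fmx S').
Proof.
have h : idem_val (idem_compl concat_idem) =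
    \sum_(i in [set rshift n j | j : 'I_n']) canon_idem concat_ring i.
  rewrite /= -(canon_idem_sum concat_ring).
  rewrite (bigID (mem [set lshift n' i | i : 'I_n])) /= addrC addrK.
  apply: eq_bigl => i; rewrite -[i]splitK; case: (split i) => j /=.
    rewrite imset_f //=; apply/esym/imsetP => -[k _ /eqP].
    by rewrite eq_lrshift.
  rewrite [RHS]imset_f //; apply/imsetP => -[k _ /eqP].
  by rewrite eq_rlshift.
have := peirce_pullback (@rshift_inj n n') h.
move=> /ring_iso_trans; apply.
pose D := glue lk lk' p q.
change (ring_iso (fmx (fm_pullback D (fun i => split (rshift n i)))) (fmx S')).
have -> : (fun i : 'I_n' => split (rshift n i)) = inr.
  by apply/funext => i; apply: (unsplitK (inr i)).
by apply: (@fmx_iso _ (fm_pullback D inr) S' (fun i j a => a) (fun i j a => a)).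
Qed.

End Concatenation.

Theorem corollary34 (n n' : nat)
  (S : fmring 'I_n) (S' : fmring 'I_n') (sigma : 'S_n) (sigma' : 'S_n')
  (S_nonsimple : ~ simple_ring (fmx S))
  (S'_nonsimple : ~ simple_ring (fmx S'))
  (S_indec : indecomposable_ring (fmx S))
  (S'_indec : indecomposable_ring (fmx S'))
  (S_basic : basic S)
  (S'_basic : basic S')
  (S_nakayama : nakayama_permutation S sigma)
  (S'_nakayama : nakayama_permutation S' sigma')
  (E : {set 'I_n}) (E' : {set 'I_n'})
  (E_nonempty : E != set0)
  (E'_nonempty : E' != set0)
  (rho : {perm {i : 'I_n | i \in E}})
  (rho' : {perm {i : 'I_n' | i \in E'}})
  (rho_restr : forall i, val (rho i) = sigma (val i))
  (rho'_restr : forall i, val (rho' i) = sigma' (val i))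
  (P_basic : basic (fm_restrict S E))
  (P'_basic : basic (fm_restrict S' E'))
  (P_nakayama : nakayama_permutation (fm_restrict S E) rho)
  (P'_nakayama : nakayama_permutation (fm_restrict S' E') rho')
  (K L : nzRingType)
  (K_skew : skew_field K)
  (L_skew : skew_field L)
  (theta : forall i, {rmorphism residue (corner (fm_restrict S E) i) -> K})
  (theta' : forall i, {rmorphism residue (corner (fm_restrict S' E') i) -> L})
  (hA : forall i, bijective (theta i))
  (hA' : forall i, bijective (theta' i))
  (hB : compatible K L)
  (hC : forall i,
     (forall m, pairing_Tr (fm_restrict S E) rho i m <->
                pairing_Tl (fm_restrict S E) rho i m) /\
     pairing_Tl_iso (fm_restrict S E) rho K theta i)
  (hC' : forall i,
     (forall m, pairing_Tr (fm_restrict S' E') rho' i m <->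
                pairing_Tl (fm_restrict S' E') rho' i m) /\
     pairing_Tl_iso (fm_restrict S' E') rho' L theta' i)
  (hD : forall i, rho i = i -> ~ simple_ring (corner (fm_restrict S E) i))
  (hD' : forall i, rho' i = i -> ~ simple_ring (corner (fm_restrict S' E') i)) :
  exists R : fmring 'I_(n + n'),
    [/\ indecomposable_ring (fmx R), basic R &
        nakayama_permutation R (concat_perm sigma sigma')] /\
    exists f : idem_elt (fmx R),
      [/\ ring_iso (peirce f) (fmx S),
          ring_iso (peirce (idem_compl f)) (fmx S') &
          (essential_right_socle (fmx R) <->
           essential_right_socle (fmx S) /\ essential_right_socle (fmx S'))].
Proof.
have S_bas := (basicP S).1 S_basic; have S'_bas := (basicP S').1 S'_basic.
have S_nak := (nakayama_permutationP sigma S_bas).1 S_nakayama.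
have S'_nak := (nakayama_permutationP sigma' S'_bas).1 S'_nakayama.
have lk := residue_link S_bas S_nak rho_restr K_skew hA
  (fun i => (hC i).1) (fun i => (hC i).2) hD.
have lk' := residue_link S'_bas S'_nak rho'_restr L_skew hA'
  (fun i => (hC' i).1) (fun i => (hC' i).2) hD'.
have [phi _] := admits_bimodule_morphism hB.1.
have [X [Y [p [q X0]]]] := exists_double_pairing phi K_skew L_skew.
pose R := concat_ring lk lk' p q.
have D_bas : basic_elt (glue lk lk' p q).
  exact: glue_basic S_bas S'_bas K_skew.1.
have R_bas : basic_elt R by apply: (pullback_basic (@splitK n n') D_bas).
exists R; split.
  split.
  - apply/indecomposable_fmxP.
    apply: (pullback_connected (@splitK n n') (@unsplitK n n')).
    apply: glue_connected => //; exact/indecomposable_fmxP.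
  - exact/basicP.
  apply/nakayama_permutationP => //.
  apply: (pullback_nakayama (@unsplitK n n') (s := sum_fun sigma sigma')).
    move=> j; rewrite permE /concat_fun.
    by case: (split j) => i; apply: (unsplitK (inl _)) || apply: (unsplitK (inr _)).
  by apply: glue_nakayama => //; exact: K_skew.1.
exists (concat_idem lk lk' p q); split.
- exact: concat_left_corner.
- exact: concat_right_corner.
rewrite (essential_right_socleP R_bas) (essential_right_socleP S_bas).
rewrite (essential_right_socleP S'_bas).
rewrite -(glue_essential lk lk' p q S_bas S'_bas K_skew.1).
exact: (pullback_essential _ (@unsplitK n n')).
Qed.
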